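(* Let $X$ be a set, $A$ a finitely generated commutative unital $\mathbb{R}$-algebra, $\bar{}\colon A\to\mathbb{R}^X$ a unital $\mathbb{R}$-algebra homomorphism, and $Q\subseteq A$ a quadratic module which is finitely generated as a quadratic module and closed under multiplication. Let $Y$, $m$, $K_{Q,X}$, $K_{Q,Y}$ be as in the context. Then: (1) The following condition Q1 holds if and only if $m(K_{Q,X})=K_{Q,Y}$. Q1: for every $f\in A$ with $\bar f>0$ on $K_{Q,X}$ there exist $p\in\sum A^2$ and $q\in Q$ with $pf=1+q$. (2) The following condition Q2 holds if and only if $\overline{m(K_{Q,X})}=K_{Q,Y}$ (closure in $Y$). Q2: for every $f\in A$ with $\bar f\ge0$ on $K_{Q,X}$ there exist $p\in\sum A^2$, $q\in Q$ and an integer $k\ge0$ with $pf=f^{2k}+q$.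
   Context: A quadratic module of $A$ is a subset $Q\subseteq A$ with $Q+Q\subseteq Q$, $a^2Q\subseteq Q$ for all $a\in A$, and $1\in Q$; it is finitely generated if $Q=\sum A^2+\sum A^2g_1+\dots+\sum A^2g_s$ for some $g_1,\dots,g_s\in A$, where $\sum A^2$ denotes the finite sums of squares in $A$. $K_{Q,X}:=\{x\in X\mid \bar g(x)\ge 0\ \forall g\in Q\}$. $Y$ denotes the set of all unital $\mathbb{R}$-algebra homomorphisms $y\colon A\to\mathbb{R}$; for $a\in A$, $\hat a(y)=y(a)$, and $Y$ carries the weakest topology making all $\hat a$ continuous. $K_{Q,Y}:=\{y\in Y\mid \hat g(y)\ge0\ \forall g\in Q\}$. The map $m\colon X\to Y$ is $m(x)(a)=\bar a(x)$. *)

(* Defs.v *)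
From HB Require Import structures.
From mathcomp Require Import all_boot all_order all_algebra.
From mathcomp Require Import all_classical all_reals all_analysis.
Set Implicit Arguments. Unset Strict Implicit. Unset Printing Implicit Defensive.
Import Order.TTheory GRing.Theory Num.Theory.
Local Open Scope ring_scope.
Local Open Scope classical_set_scope.
Import numFieldNormedType.Exports.

Section Defs.
Variables (R : realType) (A : comAlgType R).

Inductive in_subalg (s : seq A) : A -> Prop :=
  | subalg_gen a : a \in s -> in_subalg s a
  | subalg_one : in_subalg s 1
  | subalg_add a b : in_subalg s a -> in_subalg s b -> in_subalg s (a + b)
  | subalg_mul a b : in_subalg s a -> in_subalg s b -> in_subalg s (a * b)
  | subalg_scale (c : R) a : in_subalg s a -> in_subalg s (c *: a).

Definition fg_algebra : Prop := exists s : seq A, forall a : A, in_subalg s a.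

Definition sos (a : A) : Prop := exists s : seq A, a = \sum_(x <- s) x ^+ 2.

Definition quadratic_module (Q : set A) : Prop :=
  [/\ (forall a b, Q a -> Q b -> Q (a + b)),
      (forall a b, Q b -> Q (a ^+ 2 * b)) & Q 1].

Definition fg_qmodule (Q : set A) : Prop :=
  exists g : seq A, Q = [set a | exists (s0 : A) (s : 'I_(size g) -> A),
     [/\ sos s0, (forall i, sos (s i)) & a = s0 + \sum_(i < size g) s i * g`_i]].

Definition mul_closed (Q : set A) : Prop := forall a b, Q a -> Q b -> Q (a * b).

Definition alg_hom_fun (X : Type) (bar : A -> X -> R) : Prop :=
  [/\ (forall a b x, bar (a + b) x = bar a x + bar b x),
      (forall a b x, bar (a * b) x = bar a x * bar b x),
      (forall (c : R) a x, bar (c *: a) x = c * bar a x) &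
      (forall x, bar 1 x = 1)].

Definition Yset : set (A -> R) :=
  [set y | [/\ (forall a b, y (a + b) = y a + y b),
               (forall a b, y (a * b) = y a * y b),
               (forall (c : R) a, y (c *: a) = c * y a) & y 1 = 1]].

(* closure in Y, where Y carries the weakest topology making all
   evaluations y |-> y a continuous, i.e. the subspace topology induced
   by the product (pointwise) topology on R^A *)
Definition closureY (S : set (A -> R)) : set (A -> R) :=
  Yset `&` @closure ({ptws A -> R} : topologicalType) S.

Definition KQX (X : Type) (bar : A -> X -> R) (Q : set A) : set X :=
  [set x | forall g, Q g -> 0 <= bar g x].

Definition KQY (Q : set A) : set (A -> R) :=
  [set y | Yset y /\ forall g, Q g -> 0 <= y g].

Definition mmap (X : Type) (bar : A -> X -> R) (x : X) : A -> R :=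
  fun a => bar a x.

End Defs.

(* Main.v *)
(* The core is the Krivine-Stengle Positivstellensatz over A. If a preordering
   T misses all the elements -e^(2k), a maximal such preordering is a prime
   cone, so T becomes nonnegative and e nonzero in an ordered field F; let E be
   a real closed extension of F. A is a quotient of an iterated polynomial
   ring, and its generators can be moved from E down to R one at a time: the
   existence of a root of p making q_1, ..., q_m positive is read off from
   Tarski queries, which depend only on the signs of finitely many polynomials
   in the previously chosen generators. This yields a real point at which e is
   nonzero and finitely many chosen elements of T are nonnegative. With T = Q -
   fQ, this turns the equality m(K_X) = K_Y, or its closed version, into
   certificates. Conversely, the certificates separate a given point y from the
   image of m by means of sum (a - y(a))^2 and sum (a - y(a))^2 - eps^2. *)
Require Import Defs.
From HB Require Import structures.
From mathcomp Require Import all_boot all_order all_algebra.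
From mathcomp Require Import generic_quotient ring_quotient fraction.
From mathcomp Require Import all_classical all_reals all_analysis.
From mathcomp Require Import polyorder polyrcf qe_rcf_th.
From mathcomp Require Import ring zify.
Set Implicit Arguments. Unset Strict Implicit. Unset Printing Implicit Defensive.
Import Order.TTheory GRing.Theory Num.Theory.
Local Open Scope ring_scope.
Local Open Scope classical_set_scope.
Import numFieldNormedType.Exports.

(** * Preorderings and prime cones *)

Definition preordering (B : comNzRingType) (T : set B) : Prop :=
  [/\ forall a b, T a -> T b -> T (a + b),
      forall a b, T a -> T b -> T (a * b) &
      forall a, T (a ^+ 2)].

(** For [e = 1] this is properness of [T]. A general [e] is what ends up nonzero in the ordered
    field, without localizing at [e]. *)
Definition avoids (B : comNzRingType) (e : B) (T : set B) : Prop :=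
  forall k, ~ T (- e ^+ (2 * k)).

Section PreorderingTheory.
Variables (B : comNzRingType) (T : set B).
Hypothesis TP : preordering T.

Lemma preord_add a b : T a -> T b -> T (a + b).
Proof. by case: TP => + _ _; exact. Qed.

Lemma preord_mul a b : T a -> T b -> T (a * b).
Proof. by case: TP => _ + _; exact. Qed.

Lemma preord_sqr a : T (a ^+ 2).
Proof. by case: TP. Qed.

Lemma preord0 : T 0.
Proof. by have := preord_sqr 0; rewrite expr0n. Qed.

Lemma preord1 : T 1.
Proof. by have := preord_sqr 1; rewrite expr1n. Qed.

Lemma preord_even a k : T (a ^+ (2 * k)).
Proof. by rewrite mulnC exprM; exact: preord_sqr. Qed.

Lemma preord_nat n : T n%:R.
Proof.
by elim: n => [|n IH]; [exact: preord0|rewrite -addn1 natrD; exact: preord_add preord1].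
Qed.

(** The preordering generated by [T] and [f]: higher powers of [f] are absorbed because [f ^+ 2]
    lies in [T]. *)
Definition adjoin (f : B) : set B :=
  [set x | exists a b, [/\ T a, T b & x = a + f * b]].

Lemma preordering_adjoin f : preordering (adjoin f).
Proof.
split=> [x y|x y|x].
- move=> [a [b [Ta Tb ->]]] [c [d [Tc Td ->]]].
  exists (a + c), (b + d); split; [exact: preord_add..|ring].
- move=> [a [b [Ta Tb ->]]] [c [d [Tc Td ->]]].
  exists (a * c + f ^+ 2 * (b * d)), (a * d + b * c).
  split; last by ring.
    by apply: preord_add; apply: preord_mul => //; [exact: preord_sqr|exact: preord_mul].
  by apply: preord_add; exact: preord_mul.
- by exists (x ^+ 2), 0; split; [exact: preord_sqr|exact: preord0|ring].
Qed.

Lemma adjoin_sub f : T `<=` adjoin f.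
Proof. by move=> a Ta; exists a, 0; split=> //; [exact: preord0|ring]. Qed.

Lemma adjoin_gen f : adjoin f f.
Proof. by exists 0, 1; split; [exact: preord0|exact: preord1|ring]. Qed.

End PreorderingTheory.

Section PrimeCone.
Variables (B : comNzRingType) (e : B).

Lemma ex_maximal_preordering (T : set B) : preordering T -> avoids e T ->
  exists P : set B, [/\ preordering P, avoids e P, T `<=` P &
    forall C, preordering C -> avoids e C -> P `<=` C -> C `<=` P].
Proof.
move=> TP Te.
(* Zorn is applied to sets whose union with [T] is good, so that the empty chain is covered: its
   empty union contributes [T] itself. *)
have [|A [[AP Ae] Amax]] :=
    @Zorn_bigcup B [set X | preordering (X `|` T) /\ avoids e (X `|` T)].
  move=> F FP Ftot.
  have common a b : ((\bigcup_(X in F) X) `|` T) a -> ((\bigcup_(X in F) X) `|` T) b ->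
      exists Z, [/\ Z = T \/ (exists2 X, F X & Z = X `|` T), Z a & Z b].
    have mix X c d : F X -> X c -> T d -> exists Z,
        [/\ Z = T \/ (exists2 X, F X & Z = X `|` T), Z c & Z d].
      by move=> FX Xc Td; exists (X `|` T); split; [right; exists X|left|right].
    move=> [[X FX Xa]|Ta] [[Y FY Yb]|Tb].
    - have [XY|YX] := Ftot _ _ FX FY.
        by exists (Y `|` T); split; [right; exists Y|left; exact: XY|left].
      by exists (X `|` T); split; [right; exists X|left|left; exact: YX].
    - exact: (mix X).
    - by have [Z [? ? ?]] := mix _ _ _ FY Yb Ta; exists Z.
    - by exists T; split=> //; left.
  have up Z : Z = T \/ (exists2 X, F X & Z = X `|` T) ->
      preordering Z /\ Z `<=` ((\bigcup_(X in F) X) `|` T).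
    move=> [->|[X FX ->]]; first by split=> // a Ta; right.
    split; first by case: (FP _ FX).
    by move=> a [Xa|Ta]; [left; exists X|right].
  split; first split=> [a b Ha Hb|a b Ha Hb|a].
  - have [Z [/up[ZP Zsub] Za Zb]] := common _ _ Ha Hb.
    by apply: Zsub; exact: preord_add.
  - have [Z [/up[ZP Zsub] Za Zb]] := common _ _ Ha Hb.
    by apply: Zsub; exact: preord_mul.
  - by right; exact: preord_sqr.
  - move=> k [[X FX Xk]|/Te//].
    by have [_ /(_ k)] := FP _ FX; apply; left.
exists (A `|` T); split=> //.
move=> C CP Ce AC c Cc; left; apply: contrapT => Ac.
have CT : C `|` T = C.
  by apply/seteqP; split=> [a [//|Ta]|a]; [apply: AC; right|left].
apply: (Amax C); last by rewrite /= CT.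
by split=> [a Aa|/(_ c Cc)//]; apply: AC; left.
Qed.

(** By maximality, each element outside [P] has a certificate that it cannot be adjoined. Two such
    certificates multiply to one that forces some [- e ^+ (2 * m)] into [P]. *)
Lemma ex_prime_cone (T : set B) : preordering T -> avoids e T ->
  exists P : set B, [/\ preordering P, T `<=` P,
    forall a, P a \/ P (- a),
    ~ P (- e ^+ 2) &
    forall a b, P (a * b) -> P (- (a * b)) ->
      (P a /\ P (- a)) \/ (P b /\ P (- b))].
Proof.
move=> TP Te; have [P [PP Pe TsubP Pmax]] := ex_maximal_preordering TP Te.
(* Adjoining [a] gives [- e ^+ (2 * k) = p + a * q], so the displayed element is just [p]. *)
have out a : ~ P a -> exists k q, P q /\ P (- (a * q) - e ^+ (2 * k)).
  move=> Pa.
  have [|nadj] := pselect (exists k, adjoin P a (- e ^+ (2 * k))); last first.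
    case: Pa; apply: (Pmax _ (preordering_adjoin PP a)) => //.
    - by move=> k Hk; apply: nadj; exists k.
    - exact: adjoin_sub.
    - exact: adjoin_gen.
  move=> [k [p [q [Pp Pq E]]]]; exists k, q; split=> //.
  by rewrite E addrC addrK.
have mulN a b k l r s :
    P (- (a * r) - e ^+ (2 * k)) -> P (- (b * s) - e ^+ (2 * l)) ->
    P ((a * b) * (r * s) - e ^+ (2 * (k + l))).
  move=> Pu Pv.
  (* With [u], [v] the two given elements, [(a * b) * (r * s)] is
     [(u + e ^+ (2 * k)) * (v + e ^+ (2 * l))]; expand and remove the pure power of [e]. *)
  rewrite (_ : _ - _ = (- (a * r) - e ^+ (2 * k)) * (- (b * s) - e ^+ (2 * l)) +
     (e ^+ (2 * k) * (- (b * s) - e ^+ (2 * l)) + e ^+ (2 * l) * (- (a * r) - e ^+ (2 * k)))).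
    apply: preord_add => //; first exact: preord_mul.
    by apply: preord_add => //; apply: preord_mul => //; exact: preord_even.
  by rewrite mulnDr exprD; ring.
have tot a : P a \/ P (- a).
  apply: contrapT => /not_orP[/out[k [q [Pq Pu]]] /out[l [s [Ps Pv]]]].
  have Pw := mulN _ _ _ _ _ _ Pu Pv.
  apply: (Pe (k + l)%N).
  rewrite (_ : - _ = (a * - a) * (q * s) - e ^+ (2 * (k + l)) + a ^+ 2 * (q * s)); last by ring.
  apply: preord_add => //; apply: preord_mul => //; [exact: preord_sqr|exact: preord_mul].
exists P; split=> //; first by have := Pe 1%N; rewrite muln1.
(* An element outside the support is outside [P] up to sign, so replacing [a] or [b] by its negative
   leaves only the case where both are outside [P]. *)
suff main a b : P (a * b) -> P (- (a * b)) -> ~ P a -> ~ P b -> False.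
  move=> a b Pab PNab.
  have [Pa|Pa] := pselect (P a); have [Pb|Pb] := pselect (P b).
  - have [|Pa'] := pselect (P (- a)); first by left.
    have [|Pb'] := pselect (P (- b)); first by right.
    by case: (main (- a) (- b)); rewrite ?mulrNN.
  - have [|Pa'] := pselect (P (- a)); first by left.
    by case: (main (- a) b); rewrite ?mulNr ?opprK.
  - have [|Pb'] := pselect (P (- b)); first by right.
    by case: (main a (- b)); rewrite ?mulrN ?opprK.
  - by case: (main a b).
move=> Pab PNab /out[k [q [Pq Pu]]] /out[l [s [Ps Pv]]].
apply: (Pe (k + l)%N).
have Pw := mulN _ _ _ _ _ _ Pu Pv.
rewrite (_ : - _ = (a * b) * (q * s) - e ^+ (2 * (k + l)) + (- (a * b)) * (q * s)); last by ring.
by apply: preord_add => //; apply: preord_mul => //; exact: preord_mul.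
Qed.
End PrimeCone.

(** * Ordered field of fractions of a prime cone *)

Lemma fraction_numden (D : idomainType) (x : {fraction D}) :
  exists n d : D, d != 0 /\ x = tofrac n / tofrac d.
Proof.
elim/quotW: x => r.
have d0 : (frac r).2 != 0 by exact: denom_ratioP.
exists (frac r).1, (frac r).2; split; first exact: d0.
have dF : tofrac (frac r).2 != 0 by rewrite tofrac_eq0; exact: d0.
apply: (mulIf dF); rewrite divfK // !piE.
apply/eqmodP; rewrite /= FracField.equivfE /FracField.mulf.
by rewrite !numden_Ratio ?mulr1 ?mulf_neq0 ?oner_eq0 ?d0 // mulrC.
Qed.

Section ConeFractions.
Variables (B : comNzRingType) (P : set B).
Hypothesis PP : preordering P.
Hypothesis Ptot : forall a, P a \/ P (- a).
Hypothesis PN1 : ~ P (- 1).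
Hypothesis Pprime : forall a b, P (a * b) -> P (- (a * b)) ->
  (P a /\ P (- a)) \/ (P b /\ P (- b)).

Definition cone_support : {pred B} := fun a => `[< P a /\ P (- a) >].

Lemma cone_supportP a : reflect (P a /\ P (- a)) (a \in cone_support).
Proof. exact: asboolP. Qed.

(** Totality gives absorption: one of [a] and [- a] lies in [P], and the support is symmetric. *)
Lemma cone_support_idealr : idealr_closed cone_support.
Proof.
split.
- by apply/cone_supportP; rewrite oppr0; split; exact: preord0.
- by apply/cone_supportP => -[].
- move=> a u v /cone_supportP[Pu PNu] /cone_supportP[Pv PNv].
  apply/cone_supportP; rewrite opprD -mulrN.
  have [Pa|Pa] := Ptot a.
    by split; apply: preord_add => //; exact: preord_mul.
  by split; apply: preord_add => //; rewrite -mulrNN ?opprK; exact: preord_mul.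
Qed.

Lemma cone_support_prime : prime_idealr_closed cone_support.
Proof.
move=> u v /cone_supportP[Puv PNuv].
by case: (Pprime Puv PNuv) => /cone_supportP ->; rewrite ?orbT.
Qed.

HB.instance Definition _ := isIdealr.Build B cone_support cone_support_idealr.
HB.instance Definition _ :=
  isPrimeIdealrClosed.Build B cone_support cone_support_prime.

Definition cone_quot : Type := {ideal_quot cone_support}.
HB.instance Definition _ := GRing.ComNzRing.on cone_quot.

(** The fraction field is formed over an integral domain equipped with a partial inverse, which is
    chosen classically here. *)
Definition cone_quot_unit : {pred cone_quot} := fun x => `[< exists y, y * x = 1 >].
Definition cone_quot_inv (x : cone_quot) : cone_quot :=
  if pselect (exists y, y * x = 1) is left h then projT1 (cid h) else x.

Fact cone_quot_mulVx : {in cone_quot_unit, left_inverse 1 cone_quot_inv *%R}.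
Proof.
move=> x /asboolP ux; rewrite /cone_quot_inv.
by case: pselect => // h; case: cid.
Qed.

Fact cone_quot_unitPl (x y : cone_quot) : y * x = 1 -> cone_quot_unit x.
Proof. by move=> yx; apply/asboolP; exists y. Qed.

Fact cone_quot_inv_out : {in [predC cone_quot_unit], cone_quot_inv =1 id}.
Proof.
move=> x /asboolP ux; rewrite /cone_quot_inv.
by case: pselect.
Qed.

HB.instance Definition _ := GRing.ComNzRing_hasMulInverse.Build cone_quot
  cone_quot_mulVx cone_quot_unitPl cone_quot_inv_out.

Fact cone_quot_integral (x y : cone_quot) : x * y = 0 -> (x == 0) || (y == 0).
Proof. exact: Quotient.rquot_IdomainAxiom. Qed.

HB.instance Definition _ :=
  GRing.ComUnitRing_isIntegral.Build cone_quot cone_quot_integral.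

Definition cone_frac : Type := {fraction cone_quot}.
HB.instance Definition _ := GRing.Field.on cone_frac.

Definition to_cone_quot (b : B) : cone_quot := \pi_({ideal_quot cone_support})%qT b.
HB.instance Definition _ := GRing.RMorphism.copy to_cone_quot
  (\pi_({ideal_quot cone_support})%qT : B -> {ideal_quot cone_support}).

Definition to_cone_frac (b : B) : cone_frac := tofrac (to_cone_quot b).
HB.instance Definition _ := GRing.RMorphism.copy to_cone_frac
  (@tofrac cone_quot \o to_cone_quot).

Lemma to_cone_frac_eq0 a : (to_cone_frac a == 0) = (a \in cone_support).
Proof.
rewrite tofrac_eq0 -[RHS](congr1 (fun z => z \in cone_support) (subr0 a)).
by rewrite Quotient.idealrBE -[X in _ == X](rmorph0 to_cone_quot).
Qed.

Lemma ex_cone_fraction_field : exists (F : fieldType) (j : {rmorphism B -> F}),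
  (forall a, (j a == 0) = `[< P a /\ P (- a) >]) /\
  (forall x : F, exists a b, j b != 0 /\ x = j a / j b).
Proof.
exists cone_frac, to_cone_frac; split; first exact: to_cone_frac_eq0.
move=> x; have [n [d [d0 ->]]] := fraction_numden x.
exists (repr n), (repr d).
by rewrite -tofrac_eq0 in d0; rewrite /= /to_cone_frac /to_cone_quot !reprK.
Qed.

End ConeFractions.

Section OrderedFractions.
Variables (B : comNzRingType) (P : set B) (K : fieldType) (j : {rmorphism B -> K}).
Hypothesis PP : preordering P.
Hypothesis Ptot : forall a, P a \/ P (- a).
Hypothesis j_eq0 : forall a, (j a == 0) = `[< P a /\ P (- a) >].
Hypothesis j_frac : forall x : K, exists a b, j b != 0 /\ x = j a / j b.

Lemma cone_morphism_eq a b : j a = j b -> P a -> P b.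
Proof.
move=> /eqP; rewrite -subr_eq0 -rmorphB j_eq0 => /asboolP[_].
by rewrite opprB => Pba Pa; rewrite -(subrK a b); exact: preord_add.
Qed.

(** The sign of [a / b] is that of [a * b], which is [a / b] times a square; no sign has to be
    imposed on the denominator. *)
Definition frac_nonneg (x : K) : Prop :=
  exists a b, [/\ j b != 0, x = j a / j b & P (a * b)].

(** Independence of the chosen fraction. Modulo the support [a * b * d ^+ 2] equals
    [c * d * b ^+ 2], which is in [P]. If [- (a * b)] is in [P], then [a * b * d ^+ 2] is in the
    support, hence so is [a * b]. *)
Lemma frac_nonneg_div a b : j b != 0 -> frac_nonneg (j a / j b) -> P (a * b).
Proof.
move=> b0 [c [d [d0 /eqP E Pcd]]].
have [//|PNab] := Ptot (a * b).
rewrite eqr_div // -!rmorphM in E; move/eqP: E => E.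
have Pabdd : P (a * b * d ^+ 2).
  apply: (@cone_morphism_eq (c * d * b ^+ 2)); last first.
    by apply: preord_mul => //; exact: preord_sqr.
  rewrite (_ : _ * b ^+ 2 = c * b * (b * d)); last by ring.
  by rewrite rmorphM -E -rmorphM; congr (j _); ring.
have : j (a * b * d ^+ 2) == 0.
  rewrite j_eq0; apply/asboolP; split=> //.
  by rewrite -mulNr; apply: preord_mul => //; exact: preord_sqr.
rewrite rmorphM rmorphXn mulf_eq0 expf_eq0 (negPf d0) /= orbF j_eq0.
by move=> /asboolP[].
Qed.

Lemma frac_nonneg_j a : frac_nonneg (j a) <-> P a.
Proof.
split=> [|Pa]; last by exists a, 1; rewrite rmorph1 divr1 mulr1 oner_neq0.
rewrite -[j a]divr1 -(rmorph1 j) => /frac_nonneg_div.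
by rewrite mulr1 rmorph1 oner_neq0; exact.
Qed.

Definition frac_le (x y : K) : bool := `[< frac_nonneg (y - x) >].
Definition frac_lt (x y : K) : bool := (y != x) && frac_le x y.
Definition frac_norm (x : K) : K := if frac_le 0 x then x else - x.

Lemma frac_le0P x : reflect (frac_nonneg x) (frac_le 0 x).
Proof. by rewrite /frac_le subr0; exact: asboolP. Qed.

Fact frac_le0_add x y : frac_le 0 x -> frac_le 0 y -> frac_le 0 (x + y).
Proof.
move=> /frac_le0P[a [b [b0 -> Pab]]] /frac_le0P[c [d [d0 -> Pcd]]].
apply/frac_le0P; exists (a * d + c * b), (b * d); split.
- by rewrite rmorphM mulf_neq0.
- by rewrite addf_div // rmorphD !rmorphM.
- rewrite (_ : _ * _ = (a * b) * d ^+ 2 + (c * d) * b ^+ 2); last by ring.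
  by apply: preord_add => //; apply: preord_mul => //; exact: preord_sqr.
Qed.

Fact frac_le0_mul x y : frac_le 0 x -> frac_le 0 y -> frac_le 0 (x * y).
Proof.
move=> /frac_le0P[a [b [b0 -> Pab]]] /frac_le0P[c [d [d0 -> Pcd]]].
apply/frac_le0P; exists (a * c), (b * d); split.
- by rewrite rmorphM mulf_neq0.
- by rewrite mulf_div !rmorphM.
- by rewrite mulrACA; exact: preord_mul.
Qed.

Fact frac_le0_anti x : frac_le 0 x -> frac_le x 0 -> x = 0.
Proof.
have [a [b [b0 ->]]] := j_frac x.
move=> /frac_le0P /(frac_nonneg_div b0) Pab /asboolP.
rewrite sub0r -mulNr -rmorphN => /(frac_nonneg_div b0) PNab.
have /asboolP : P (a * b) /\ P (- (a * b)) by rewrite -mulNr.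
rewrite -j_eq0 rmorphM mulf_eq0 (negPf b0) orbF => /eqP ->.
by rewrite mul0r.
Qed.

Fact frac_sub_ge0 x y : frac_le 0 (y - x) = frac_le x y.
Proof. by rewrite /frac_le subr0. Qed.

Fact frac_le0_total x : frac_le 0 x || frac_le x 0.
Proof.
have [a [b [b0 ->]]] := j_frac x.
have [Pab|PNab] := Ptot (a * b); apply/orP; [left|right].
  by apply/frac_le0P; exists a, b.
apply/asboolP; exists (- a), b; split=> //; first by rewrite sub0r rmorphN mulNr.
by rewrite mulNr.
Qed.

Fact frac_normN x : frac_norm (- x) = frac_norm x.
Proof.
rewrite /frac_norm opprK.
have NE y : frac_le 0 (- y) = frac_le y 0 by rewrite /frac_le subr0 sub0r.
rewrite NE; have := frac_le0_total x.
have [x0|_] := boolP (frac_le x 0); have [y0|_] //= := boolP (frac_le 0 x).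
by rewrite (frac_le0_anti y0 x0) oppr0.
Qed.

Fact frac_ge0_norm x : frac_le 0 x -> frac_norm x = x.
Proof. by rewrite /frac_norm => ->. Qed.

Fact frac_lt_def x y : frac_lt x y = (y != x) && frac_le x y.
Proof. by []. Qed.

Definition ordered_cone_frac : Type := K.
HB.instance Definition _ := GRing.Field.on ordered_cone_frac.
HB.instance Definition _ := Num.IntegralDomain_isLeReal.Build ordered_cone_frac
  frac_le0_add frac_le0_mul frac_le0_anti frac_sub_ge0 frac_le0_total
  frac_normN frac_ge0_norm frac_lt_def.

Lemma ex_ordered_fractions : exists (F : realFieldType) (h : {rmorphism B -> F}),
  (forall b, (0 <= h b) <-> P b) /\
  (forall x : F, exists a b, h b != 0 /\ x = h a / h b).
Proof.
exists ordered_cone_frac, j; split; last exact: j_frac.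
move=> b; split=> [h0|Pb].
  by apply/frac_nonneg_j/frac_le0P; exact: h0.
by apply/frac_le0P/frac_nonneg_j.
Qed.

End OrderedFractions.

(** With [e = 1] this builds the root extensions, the field attached to the product and the limit
    field; with general [e] it gives the ordered field behind the certificates. *)
Theorem preordering_real_field (B : comNzRingType) (e : B) (T : set B) :
  preordering T -> avoids e T ->
  exists (F : realFieldType) (h : {rmorphism B -> F}),
    [/\ forall b, T b -> 0 <= h b, h e != 0 &
     forall x : F, exists a b, h b != 0 /\ x = h a / h b].
Proof.
move=> TP Te; have [P [PP TsubP Ptot PNe Pprime]] := ex_prime_cone TP Te.
have PN1 : ~ P (- 1).
  move=> PN1; apply: PNe; rewrite -[- _]mulN1r.
  by apply: preord_mul => //; exact: preord_sqr.
have [K [j [j0 jfrac]]] := ex_cone_fraction_field PP Ptot PN1 Pprime.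
have [F [h [hP hfrac]]] := ex_ordered_fractions PP Ptot j0 jfrac.
exists F, h; split=> // [b /TsubP/hP//|].
apply: contra_notN PNe => /eqP he0; apply/hP.
by rewrite rmorphN rmorphXn he0 expr0n /= oppr0.
Qed.

(** * Adjoining a root of a sign-changing polynomial *)

Definition order_morphism (F F' : realFieldType) (h : {rmorphism F -> F'}) : Prop :=
  forall x, 0 <= x -> 0 <= h x.

Definition sign_change (F : realFieldType) (p : {poly F}) : Prop :=
  exists a b, p.[a] * p.[b] < 0.

Section RootExtension.
Variable F : realFieldType.
Implicit Types p f g : {poly F}.

(** Nonnegative constants of [F] need not be squares; the weights force them to stay nonnegative in
    the extension. *)
Inductive weighted_sos : {poly F} -> Prop :=
| wsos0 : weighted_sos 0
| wsosD c g f : 0 <= c -> weighted_sos f -> weighted_sos (c *: g ^+ 2 + f).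

Lemma wsos_add f g : weighted_sos f -> weighted_sos g -> weighted_sos (f + g).
Proof.
move=> + wg; elim=> [|c h {}f c0 _ IH]; first by rewrite add0r.
by rewrite -addrA; exact: wsosD.
Qed.

Lemma wsos_sqr c f : 0 <= c -> weighted_sos (c *: f ^+ 2).
Proof. by move=> c0; rewrite -[_ *: _]addr0; apply: wsosD => //; exact: wsos0. Qed.

Lemma wsos_mul f g : weighted_sos f -> weighted_sos g -> weighted_sos (f * g).
Proof.
move=> + wg; elim=> [|c h {}f c0 _ IH]; first by rewrite mul0r; exact: wsos0.
rewrite mulrDl; apply: wsos_add => // {f IH}.
elim: wg => [|d k g' d0 _ IH]; first by rewrite mulr0; exact: wsos0.
rewrite mulrDr; apply: wsos_add => //.
by rewrite -scalerAl -scalerAr scalerA -exprMn; apply: wsos_sqr; exact: mulr_ge0.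
Qed.

Lemma wsos_ge0 f x : weighted_sos f -> 0 <= f.[x].
Proof.
elim=> [|c h {}f c0 _ IH]; first by rewrite horner0.
by rewrite hornerD hornerZ horner_exp addr_ge0 // mulr_ge0 // sqr_ge0.
Qed.

(** Reducing each squared polynomial modulo [p] leaves degree at most 2 deg [p] - 2, written here as
    a size. A multiple of [p] of that degree has a cofactor of degree below deg [p]. *)
Lemma wsos_mod p f : p != 0 -> weighted_sos f ->
  exists f', [/\ weighted_sos f', p %| f - f' & (size f' <= ((size p).-1).*2.-1)%N].
Proof.
move=> p0; elim=> [|c h {}f c0 _ [f' [wf' pf' sf']]].
  by exists 0; rewrite subrr size_poly0 dvdp0; split=> //; exact: wsos0.
exists (c *: (h %% p) ^+ 2 + f'); split; first exact: wsosD.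
  rewrite opprD addrACA dvdp_add // -scalerBr -mul_polyC dvdp_mull // subr_sqr dvdp_mulr //.
  by rewrite {1}(divp_eq h p) addrK dvdp_mull.
rewrite (leq_trans (size_polyD _ _)) // geq_max sf' andbT.
rewrite (leq_trans (size_scale_leq _ _)) // expr2 (leq_trans (size_polyMleq _ _)) //.
have : (size (h %% p)%R < size p)%N by rewrite ltn_modp.
move: (size (h %% p)%R) (size p) => m n; lia.
Qed.

(* If p divides 1 + f with f reduced mod p, the cofactor has smaller degree and
   still changes sign. *)
Lemma sign_change_not_dvd p f : sign_change p -> weighted_sos f -> ~~ (p %| 1 + f).
Proof.
move=> [a [b pab]]; have [n] := ubnP (size p).
elim: n => // n IH in p pab f *; rewrite ltnS => sp wf; apply/negP => pf.
have p0 : p != 0 by apply: contraTneq pab => ->; rewrite !horner0 mul0r ltxx.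
have [g [wg pfg sg]] := wsos_mod p0 wf.
have /dvdpP[h E] : p %| 1 + g.
  have -> : 1 + g = (1 + f) - (f - g) by rewrite opprB addrACA subrr addr0.
  exact: dvdp_sub.
have pos x : 0 < h.[x] * p.[x].
  by rewrite -hornerM -E hornerD hornerC ltr_wpDr // ?wsos_ge0 // ltr01.
have h0 : h != 0 by apply: contraTneq (pos 0) => ->; rewrite horner0 mul0r ltxx.
(* As [h * p = 1 + g] is positive everywhere, [h] has the sign of [p] at both points. *)
have hab : h.[a] * h.[b] < 0.
  have := mulr_gt0 (pos a) (pos b); rewrite mulrACA => H.
  by rewrite -(nmulr_lgt0 _ pab).
have := size_mul h0 p0; rewrite -E => sE.
have sp2 : (1 < size p)%N.
  rewrite ltnNge; apply/negP => /size1_polyC pC.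
  by move: pab; rewrite pC !hornerC -expr2 ltNge sqr_ge0.
have s1 : (size (1 + g)%R <= ((size p).-1).*2.-1)%N.
  rewrite (leq_trans (size_polyD _ _)) // geq_max sg andbT size_poly1.
  by move: sp2; move: (size p) => m; lia.
have sh : (size h < n)%N.
  move: sE s1 sp2 sp; move: h0; rewrite -size_poly_gt0.
  by move: (size h) (size p) (size (1 + g)%R) => m k l; lia.
have /negP[] := IH _ hab _ sh wg.
by rewrite E dvdp_mulr.
Qed.

(** The preimage in F[X] of the weighted sums of squares of F[X]/(p). *)
Definition dvd_wsos p : set {poly F} :=
  [set f | exists2 g, weighted_sos g & p %| f - g].

Lemma preordering_dvd_wsos p : preordering (dvd_wsos p).
Proof.
split=> [f g [f' wf pf] [g' wg pg]|f g [f' wf pf] [g' wg pg]|f].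
- by exists (f' + g'); [exact: wsos_add|rewrite opprD addrACA dvdp_add].
- exists (f' * g'); first exact: wsos_mul.
  rewrite (_ : _ - _ = f * (g - g') + (f - f') * g'); last first.
    by rewrite mulrBr mulrBl addrA subrK.
  by apply: dvdp_add; [exact: dvdp_mull|exact: dvdp_mulr].
- by exists (f ^+ 2); [rewrite -[_ ^+ 2]scale1r; exact: wsos_sqr|rewrite subrr dvdp0].
Qed.

(** Both [p] and [- p] lie in [dvd_wsos p], so [p] vanishes in the ordered field and the image of
    ['X] is a root. *)
Lemma ex_root_extension p : sign_change p ->
  exists (F' : realFieldType) (h : {rmorphism F -> F'}),
    order_morphism h /\ exists x, root (map_poly h p) x.
Proof.
move=> sp; have [|F' [h [hT _ _]]] :=
    @preordering_real_field _ 1 (dvd_wsos p) (preordering_dvd_wsos p).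
  move=> k; rewrite expr1n => -[g wg]; rewrite -opprD dvdpNr.
  by apply/negP; exact: sign_change_not_dvd.
exists F', (h \o polyC); split=> [c c0|].
  apply: hT; exists (c *: 1 ^+ 2); first exact: wsos_sqr.
  by rewrite expr1n alg_polyC subrr dvdp0.
exists (h 'X); rewrite map_poly_comp rootE horner_map /=.
rewrite -[(map_poly _ _).['X]]/(p \Po 'X) comp_polyXr eq_le; apply/andP; split.
  rewrite -oppr_ge0 -rmorphN; apply: hT; exists 0; first exact: wsos0.
  by rewrite subr0 dvdpNr dvdpp.
by apply: hT; exists 0; [exact: wsos0|rewrite subr0 dvdpp].
Qed.

End RootExtension.

(** * Adjoining all roots at once *)

Lemma order_morphism_lt0 (F F' : realFieldType) (h : {rmorphism F -> F'}) x :
  order_morphism h -> x < 0 -> h x < 0.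
Proof.
move=> hP x0; rewrite lt_neqAle fmorph_eq0 (lt_eqF x0) /= -oppr_ge0 -rmorphN.
by apply: hP; rewrite oppr_ge0 ltW.
Qed.

Lemma sign_change_map (F F' : realFieldType) (h : {rmorphism F -> F'}) p :
  order_morphism h -> sign_change p -> sign_change (map_poly h p).
Proof.
move=> hP [a [b pab]]; exists (h a), (h b).
by rewrite !horner_map -rmorphM; exact: order_morphism_lt0.
Qed.

Lemma ex_root_extension_seq (F : realFieldType) (L : seq {poly F}) :
  exists (F' : realFieldType) (h : {rmorphism F -> F'}), order_morphism h /\
    forall p, p \in L -> sign_change p -> exists x, root (map_poly h p) x.
Proof.
elim: L => [|p L [F' [h [hP hL]]]]; first by exists F, idfun; split.
have [sp|nsp] := pselect (sign_change p); last first.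
  by exists F', h; split=> // q; rewrite inE => /predU1P[->|]; [|exact: hL].
have [F'' [h' [h'P [x rx]]]] := ex_root_extension (sign_change_map hP sp).
exists F'', (h' \o h); split=> [y y0|q]; first by apply/h'P/hP.
rewrite inE => /predU1P[->|qL] sq; first by exists x; rewrite map_poly_comp.
have [y ry] := hL q qL sq; exists (h' y).
by rewrite map_poly_comp rootE horner_map (rootP ry) rmorph0.
Qed.

(* The index [i0] only witnesses that the product is a nonzero ring. *)
Definition fam_prod (I : Type) (i0 : I) (F : I -> realFieldType) : Type :=
  forall i, F i.

Section FamProd.
Variables (I : Type) (i0 : I) (F : I -> realFieldType).
Local Notation prod := (fam_prod i0 F).

HB.instance Definition _ := gen_eqMixin prod.
HB.instance Definition _ := gen_choiceMixin prod.

Let add (x y : prod) : prod := fun i => x i + y i.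
Let opp (x : prod) : prod := fun i => - x i.
Let zero : prod := fun i => 0.
Let mul (x y : prod) : prod := fun i => x i * y i.
Let one : prod := fun i => 1.

Fact fam_prod_addA : associative add.
Proof. by move=> x y z; apply: functional_extensionality_dep => i; exact: addrA. Qed.
Fact fam_prod_addC : commutative add.
Proof. by move=> x y; apply: functional_extensionality_dep => i; exact: addrC. Qed.
Fact fam_prod_add0 : left_id zero add.
Proof. by move=> x; apply: functional_extensionality_dep => i; exact: add0r. Qed.
Fact fam_prod_addN : left_inverse zero opp add.
Proof. by move=> x; apply: functional_extensionality_dep => i; exact: addNr. Qed.

HB.instance Definition _ := GRing.isZmodule.Build prod
  fam_prod_addA fam_prod_addC fam_prod_add0 fam_prod_addN.

Fact fam_prod_mulA : associative mul.
Proof. by move=> x y z; apply: functional_extensionality_dep => i; exact: mulrA. Qed.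
Fact fam_prod_mulC : commutative mul.
Proof. by move=> x y; apply: functional_extensionality_dep => i; exact: mulrC. Qed.
Fact fam_prod_mul1 : left_id one mul.
Proof. by move=> x; apply: functional_extensionality_dep => i; exact: mul1r. Qed.
Fact fam_prod_mulD : left_distributive mul +%R.
Proof. by move=> x y z; apply: functional_extensionality_dep => i; exact: mulrDl. Qed.
Fact fam_prod_one_neq0 : one != 0.
Proof.
by apply/eqP => /(congr1 (fun x : prod => x i0)) /eqP; rewrite oner_eq0.
Qed.

HB.instance Definition _ := GRing.Zmodule_isComNzRing.Build prod
  fam_prod_mulA fam_prod_mulC fam_prod_mul1 fam_prod_mulD fam_prod_one_neq0.

Definition fam_proj (i : I) (x : prod) : F i := x i.

HB.instance Definition _ i := GRing.isZmodMorphism.Build prod (F i) (fam_proj i)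
  (fun _ _ => erefl).
HB.instance Definition _ i := GRing.isMonoidMorphism.Build prod (F i) (fam_proj i)
  (erefl, fun _ _ => erefl).

Section Diagonal.
Variables (K : realFieldType) (h : forall i, {rmorphism K -> F i}).

Definition fam_diag (c : K) : prod := fun i => h i c.

Fact fam_diag_zmod : zmod_morphism fam_diag.
Proof. by move=> x y; apply: functional_extensionality_dep => i; exact: rmorphB. Qed.
Fact fam_diag_monoid : monoid_morphism fam_diag.
Proof.
split=> [|x y]; apply: functional_extensionality_dep => i; first exact: rmorph1.
exact: rmorphM.
Qed.
HB.instance Definition _ := GRing.isZmodMorphism.Build K prod fam_diag fam_diag_zmod.
HB.instance Definition _ := GRing.isMonoidMorphism.Build K prod fam_diag fam_diag_monoid.
End Diagonal.

End FamProd.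

(* F' is an ordered field attached to the product of extensions F_L, where F_L
   handles the finite list L, preordered by nonnegativity for all large L. *)
Lemma ex_all_root_extension (F : realFieldType) :
  exists (F' : realFieldType) (h : {rmorphism F -> F'}), order_morphism h /\
    forall p : {poly F}, sign_change p -> exists x, root (map_poly h p) x.
Proof.
pose E L := projT1 (cid (@ex_root_extension_seq F L)).
pose g L : {rmorphism F -> E L} :=
  projT1 (cid (projT2 (cid (@ex_root_extension_seq F L)))).
have gP L := projT2 (cid (projT2 (cid (@ex_root_extension_seq F L)))).
rewrite -/(E _) -/(g _) in gP.
pose B := fam_prod [::] E.
pose T : set B := [set b : B | exists L0 : seq {poly F},
  forall L : seq {poly F}, {subset L0 <= L} -> 0 <= b L].
have TP : preordering T.
  split=> [a b [L La] [M Mb]|a b [L La] [M Mb]|a].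
  - exists (L ++ M) => N LMN.
    by apply: addr_ge0; [apply: La|apply: Mb] => x xL; apply: LMN; rewrite mem_cat xL ?orbT.
  - exists (L ++ M) => N LMN.
    by apply: mulr_ge0; [apply: La|apply: Mb] => x xL; apply: LMN; rewrite mem_cat xL ?orbT.
  - by exists [::] => L _; exact: sqr_ge0.
have T1 : avoids 1 T.
  move=> k [L /(_ L)]; rewrite expr1n => /(_ (fun _ => id)) N1.
  by have : 0 <= - 1 :> E L := N1; rewrite oppr_ge0 ler10.
have [F' [h [hT _ _]]] := preordering_real_field TP T1.
(* An element vanishing at all large [L] lies in [T] together with its negative, so [h] kills it. *)
have h0 (b : B) (L0 : seq {poly F}) :
    (forall L : seq {poly F}, {subset L0 <= L} -> b L = 0) -> h b = 0.
  move=> bL; apply/eqP; rewrite eq_le -oppr_ge0 -rmorphN.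
  by apply/andP; split; apply: hT; exists L0 => L /bL;
    rewrite -?[(- b) L]/(- (b L)) => ->; rewrite ?oppr0.
exists F', (h \o fam_diag [::] g); split=> [c c0|p sp].
  by apply: hT; exists [::] => L _; have [gL _] := gP L; exact: gL.
(* Coordinates at lists without [p] are arbitrary: [h] only sees the lists that contain [p]. *)
have ex_x (L : seq {poly F}) : exists x : E L, p \in L -> root (map_poly (g L) p) x.
  have [_ gL] := gP L; have [pL|] := boolP (p \in L); last by exists 0.
  by have [x rx] := gL p pL sp; exists x.
pose x : B := fun L => projT1 (cid (ex_x L)).
exists (h x); rewrite map_poly_comp rootE horner_map; apply/eqP.
apply: (h0 _ [:: p]) => L pL.
rewrite -[LHS]/(fam_proj L _) -horner_map -map_poly_comp.
apply/rootP; apply: (projT2 (cid (ex_x L))).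
by apply: pL; rewrite mem_head.
Qed.

(** * Real closure as a limit *)

(** A root [x] may fall outside [[a, b]]. Then ['X - x] has constant sign there, so the quotient by
    it still changes sign between [a] and [b], in lower degree. *)
Lemma real_closed_of_roots (E : realFieldType) :
  (forall p : {poly E}, sign_change p -> exists x, root p x) ->
  Num.real_closed_axiom E.
Proof.
move=> wr; suff main (p : {poly E}) a b : a <= b -> p.[a] * p.[b] < 0 ->
    exists2 x, a <= x <= b & root p x.
  move=> p a b ab /andP[pa pb].
  have [pa0|pa0] := eqVneq p.[a] 0; first by exists a; rewrite ?lexx ?rootE ?pa0.
  have [pb0|pb0] := eqVneq p.[b] 0; first by exists b; rewrite ?lexx ?andbT ?rootE ?pb0.
  by apply: main => //; rewrite pmulr_llt0 lt_neqAle ?pa0 // eq_sym pb0.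
have [n] := ubnP (size p); elim: n => // n IH in p *; rewrite ltnS => sp ab pab.
have [x px] : exists x, root p x by apply: wr; exists a, b.
have [xab|xab] := boolP (a <= x <= b); first by exists x.
have /factor_theorem[q E1] := px.
have dx : 0 < (a - x) * (b - x).
  move: xab; rewrite negb_and -!ltNge => /orP[xa|bx].
    by rewrite mulr_gt0 ?subr_gt0 // (lt_le_trans xa).
  by rewrite nmulr_rgt0 subr_lt0 // (le_lt_trans ab).
have qab : q.[a] * q.[b] < 0.
  rewrite -(pmulr_llt0 _ dx) (_ : _ * _ = p.[a] * p.[b]) //.
  by rewrite E1 !hornerM !hornerXsubC; ring.
have q0 : q != 0 by apply: contraTneq qab => ->; rewrite !horner0 mul0r ltxx.
have [|y yab qy] := IH q _ ab qab.
  by apply: leq_trans sp; rewrite E1 size_Mmonic ?monicXsubC // size_XsubC addn2.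
by exists y => //; rewrite E1 rootM qy.
Qed.

Section Tower.
Variables (F : nat -> realFieldType) (i : forall n, {rmorphism F n -> F n.+1}).
Hypothesis iP : forall n, order_morphism (i n).
Hypothesis i_root : forall n (p : {poly F n}), sign_change p ->
  exists x, root (map_poly (i n) p) x.

Local Notation prod := (fam_prod 0%N F).

Definition coherent_from (n : nat) (x : prod) : Prop :=
  forall m, (n <= m)%N -> x m.+1 = i m (x m).

(** Eventually coherent sequences represent the direct limit of the tower. Sequences that eventually
    agree are identified later, by the support of a prime cone. *)
Definition is_thread : {pred prod} := fun x => `[< exists n, coherent_from n x >].

Lemma is_threadP x : reflect (exists n, coherent_from n x) (x \in is_thread).
Proof. exact: asboolP. Qed.

Fact is_thread_subring : subring_closed is_thread.
Proof.
split.
- by apply/is_threadP; exists 0%N => m _; rewrite [RHS]rmorph1.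
- move=> x y /is_threadP[n xn] /is_threadP[k yk]; apply/is_threadP; exists (maxn n k) => m.
  rewrite geq_max => /andP[/xn xE /yk yE].
  by rewrite -[LHS]/(x m.+1 - y m.+1) xE yE -rmorphB.
- move=> x y /is_threadP[n xn] /is_threadP[k yk]; apply/is_threadP; exists (maxn n k) => m.
  rewrite geq_max => /andP[/xn xE /yk yE].
  by rewrite -[LHS]/(x m.+1 * y m.+1) xE yE -rmorphM.
Qed.

HB.instance Definition _ := GRing.isSubringClosed.Build prod is_thread is_thread_subring.

Record thread := Thread { thread_val :> prod; _ : thread_val \in is_thread }.
HB.instance Definition _ := [isSub for thread_val].
HB.instance Definition _ := [Choice of thread by <:].
HB.instance Definition _ := [SubChoice_isSubComNzRing of thread by <:].

Definition thread_proj n (x : thread) : F n := fam_proj n (val x).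
HB.instance Definition _ n := GRing.RMorphism.copy (thread_proj n)
  (@fam_proj _ 0%N F n \o (val : thread -> prod)).

Lemma threadP (x : thread) : exists n, forall m, (n <= m)%N ->
  thread_proj m.+1 x = i m (thread_proj m x).
Proof. by have /is_threadP := valP x. Qed.

Lemma ex_thread n (v : F n) : exists x : thread, thread_proj n x = v /\
  forall m, (n <= m)%N -> thread_proj m.+1 x = i m (thread_proj m x).
Proof.
(* The thread is 0 before stage [n], equals [v] (transported along [n = m]) at stage [n], and
   follows the maps [i] afterwards. *)
pose g := fix g m : F m := match m return F m with
  | 0%N => if pselect (n = 0%N) is left e then eq_rect n F v _ e else 0
  | m'.+1 => if pselect (n = m'.+1) is left e then eq_rect n F v _ e else i m' (g m')
  end.
have gn : g n = v.
  have cast (e : n = n) : eq_rect n F v n e = v by rewrite (Prop_irrelevance e erefl).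
  suff : forall m (e : n = m), g m = eq_rect n F v m e by move=> /(_ n erefl).
  by case=> [|m] e /=; case: pselect => // e'; rewrite (Prop_irrelevance e e').
have gc m : (n <= m)%N -> g m.+1 = i m (g m).
  by move=> nm /=; case: pselect => // e; exfalso; move: nm; rewrite e ltnn.
have gT : (g : prod) \in is_thread by apply/is_threadP; exists n.
by exists (Thread gT).
Qed.

Lemma thread_eq0 n (x : thread) k :
  (forall m, (n <= m)%N -> thread_proj m.+1 x = i m (thread_proj m x)) ->
  (n <= k)%N -> thread_proj n x = 0 -> thread_proj k x = 0.
Proof.
move=> xc + x0; elim: k => [|k IH]; first by rewrite leqn0 => /eqP <-.
rewrite leq_eqVlt => /predU1P[<-//|]; rewrite ltnS => nk.
by rewrite xc // IH // rmorph0.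
Qed.

Definition thread_nonneg : set thread :=
  [set x | exists n, forall m, (n <= m)%N -> 0 <= thread_proj m x].

Lemma preordering_thread_nonneg : preordering thread_nonneg.
Proof.
split=> [x y [n xn] [k yk]|x y [n xn] [k yk]|x].
- exists (maxn n k) => m; rewrite geq_max => /andP[/xn x0 /yk y0].
  by rewrite rmorphD addr_ge0.
- exists (maxn n k) => m; rewrite geq_max => /andP[/xn x0 /yk y0].
  by rewrite rmorphM mulr_ge0.
- by exists 0%N => m _; rewrite rmorphXn sqr_ge0.
Qed.

(** Surjectivity holds because a thread [b] with [h b != 0] is nonzero at all late stages, so its
    stagewise inverse represents the inverse of [h b]. *)
Lemma ex_limit_field :
  exists (E : realFieldType) (h : {rmorphism thread -> E}),
    [/\ forall x, thread_nonneg x -> 0 <= h x & forall e, exists x, e = h x].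
Proof.
have [|E [h [hT _ hfrac]]] := @preordering_real_field _ 1 _ preordering_thread_nonneg.
  by move=> k [n /(_ n (leqnn n))]; rewrite expr1n rmorphN1 oppr_ge0 ler10.
exists E, h; split=> // e; have [a [b [hb ->]]] := hfrac e.
have [n bn] := threadP b.
(* Field morphisms commute with inversion, with [0^-1 = 0], so stagewise inversion keeps coherence
   even where [b] vanishes. *)
have [c cb] : exists c : thread, forall m, (n <= m)%N ->
    thread_proj m c = (thread_proj m b)^-1.
  have cT : ((fun m => (thread_proj m b)^-1) : prod) \in is_thread.
    by apply/is_threadP; exists n => m /bn bE; rewrite bE fmorphV.
  by exists (Thread cT).
have h0 x k : (forall m, (k <= m)%N -> thread_proj m x = 0) -> h x = 0.
  move=> x0; apply/eqP; rewrite eq_le -oppr_ge0 -rmorphN.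
  apply/andP; split; apply: hT; exists k => m km; last by rewrite x0.
  by rewrite rmorphN /= x0 ?oppr0.
have bn0 : thread_proj n b != 0.
  apply: contraNneq hb => b0; apply/eqP/(h0 _ n) => m nm.
  exact: thread_eq0 b0.
have bm0 m : (n <= m)%N -> thread_proj m b != 0.
  elim: m => [|m IH]; first by rewrite leqn0 => /eqP <-.
  rewrite leq_eqVlt => /predU1P[<-//|]; rewrite ltnS => nm.
  by rewrite bn // fmorph_eq0 IH.
exists (a * c); rewrite rmorphM; congr (_ * _).
apply: (mulfI hb); rewrite divff // -rmorphM -(rmorph1 h); apply/eqP.
rewrite eq_sym -subr_eq0 -rmorphB; apply/eqP/(h0 _ n) => m nm.
by rewrite rmorphB rmorphM rmorph1 /= cb // divff ?subrr // bm0.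
Qed.

Lemma poly_threadP (P : {poly thread}) : exists n, forall m, (n <= m)%N ->
  map_poly (thread_proj m.+1) P = map_poly (i m) (map_poly (thread_proj m) P).
Proof.
have /choice[s sP] := fun k => threadP P`_k.
exists (\max_(k < size P) s k) => m nm; apply/polyP => k; rewrite !coef_map /=.
have [kP|/(nth_default 0)->] := ltnP k (size P); last by rewrite !rmorph0.
by apply: sP; apply: leq_trans nm; exact: (leq_bigmax (Ordinal kP)).
Qed.

(** A polynomial and its sign change lift to threads and are already present at some stage [N]; a
    root then exists at stage [N.+1] and persists. *)
Lemma limit_field_roots (E : realFieldType) (h : {rmorphism thread -> E}) :
  (forall x, thread_nonneg x -> 0 <= h x) -> (forall e, exists x, e = h x) ->
  forall p : {poly E}, sign_change p -> exists x, root p x.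
Proof.
move=> hT hsurj p.
have /choice[s sE] := hsurj.
have [P ->] : exists P, p = map_poly h P.
  exists (\poly_(k < size p) s p`_k); apply/polyP => k; rewrite coef_map coef_poly /=.
  by case: ltnP => [_|/(nth_default 0)->]; rewrite ?rmorph0 // -sE.
move=> [a [b]]; rewrite (sE a) (sE b) !horner_map -rmorphM.
move: (s a) (s b) => {}a {}b.
set c := _ * _ => hc.
have [n cn] := threadP c; have [k Pk] := poly_threadP P.
pose N := maxn n k.
have cN m : (N <= m)%N -> thread_proj m.+1 c = i m (thread_proj m c).
  by rewrite geq_max => /andP[nm _]; exact: cn.
have PN m : (N <= m)%N ->
    map_poly (thread_proj m.+1) P = map_poly (i m) (map_poly (thread_proj m) P).
  by rewrite geq_max => /andP[_ km]; exact: Pk.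
have cN0 : thread_proj N c < 0.
  rewrite ltNge; apply/negP => c0; move: hc; apply/negP; rewrite -leNgt.
  apply: hT; exists N; elim=> [|m IH]; first by rewrite leqn0 => /eqP <-.
  rewrite leq_eqVlt => /predU1P[<-//|]; rewrite ltnS => Nm.
  by rewrite cN //; apply: iP; exact: IH.
have [|x] := @i_root N (map_poly (thread_proj N) P).
  by exists (thread_proj N a), (thread_proj N b); rewrite !horner_map -rmorphM.
rewrite -PN // => /rootP rx.
have [y [yx yc]] := ex_thread x.
have Py m : (N < m)%N -> thread_proj m P.[y] = 0.
  elim: m => // m IH; rewrite ltnS leq_eqVlt => /predU1P[E1|Nm].
    by rewrite -E1 -horner_map /= yx.
  by rewrite -horner_map PN 1?ltnW //= yc // horner_map horner_map /= IH // rmorph0.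
exists (h y); rewrite rootE horner_map eq_le -oppr_ge0 -rmorphN.
by apply/andP; split; apply: hT; exists N.+1 => m Nm; rewrite ?rmorphN /= Py ?oppr0.
Qed.

Lemma ex_real_closed_limit :
  exists (E : rcfType) (h : {rmorphism F 0%N -> E}), order_morphism h.
Proof.
have [E [h [hT hsurj]]] := ex_limit_field.
pose Ercf : rcfType := HB.pack (Num.RealField.sort E)
  (Num.RealField.class E)
  (Num.RealField_isClosed.Build E (real_closed_of_roots (limit_field_roots hT hsurj))).
pose c v := fun m => nat_rect F v (fun k y => i k y) m.
have c_thread v : (c v : prod) \in is_thread by apply/is_threadP; exists 0%N.
pose d v : thread := Thread (c_thread v).
have dE (u v : thread) : (forall m, thread_proj m u = thread_proj m v) -> u = v.
  by move=> uv; apply: val_inj; apply: functional_extensionality_dep.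
have d_zmod : zmod_morphism d.
  move=> u v; apply: dE => m; rewrite rmorphB.
  by elim: m => // m; rewrite /thread_proj /= /fam_proj /= => ->; rewrite rmorphB.
have d_monoid : monoid_morphism d.
  split=> [|u v]; apply: dE => m; rewrite ?rmorph1 ?rmorphM;
    elim: m => // m; rewrite /thread_proj /= /fam_proj /= => ->; by rewrite ?rmorph1 ?rmorphM.
pose dR : {rmorphism F 0%N -> thread} := HB.pack d
  (GRing.isZmodMorphism.Build _ _ d d_zmod) (GRing.isMonoidMorphism.Build _ _ d d_monoid).
exists Ercf, (h \o dR) => x x0; apply: (hT (d x)); exists 0%N.
by elim=> // m IH _; apply: iP; exact: IH.
Qed.

End Tower.

(** One step provides roots only for polynomials over the old field; countably many steps also reach
    those with coefficients in the new fields. *)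
Theorem ex_real_closure (F : realFieldType) :
  exists (E : rcfType) (h : {rmorphism F -> E}), order_morphism h.
Proof.
pose nxt (K : realFieldType) := projT1 (cid (ex_all_root_extension K)).
pose inc (K : realFieldType) : {rmorphism K -> nxt K} :=
  projT1 (cid (projT2 (cid (ex_all_root_extension K)))).
have incP (K : realFieldType) := projT2 (cid (projT2 (cid (ex_all_root_extension K)))).
rewrite -/(nxt _) -/(inc _) in incP.
pose tower n := iter n nxt F.
apply: (@ex_real_closed_limit tower (fun n => inc (tower n))) => n.
  by have [] := incP (tower n).
by have [_] := incP (tower n); exact.
Qed.

(** * Tarski queries and change of the real closed field *)

Section SignCompatibility.
Variables (D : comNzRingType) (E K : rcfType) (psi : {rmorphism D -> E}).
Implicit Types (phi : {rmorphism D -> K}) (P Q : {poly D}) (G : seq D).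

(** Signs are prescribed on a finite list only, but the whole kernel of [psi] must be killed, so
    that [phi] factors through any quotient of [D] through which [psi] does. *)
Definition sign_compatible G phi : Prop :=
  (forall d, psi d = 0 -> phi d = 0) /\
  (forall d, d \in G -> sgz (phi d) = sgz (psi d)).

(** Plays the role of a neighbourhood filter of [psi]: finitely many signs guarantee [X]. *)
Definition near_psi (X : {rmorphism D -> K} -> Prop) : Prop :=
  exists G, forall phi, sign_compatible G phi -> X phi.

Lemma near_psi_and (X Y : {rmorphism D -> K} -> Prop) :
  near_psi X -> near_psi Y -> near_psi (fun phi => X phi /\ Y phi).
Proof.
move=> [G XG] [H YH]; exists (G ++ H) => phi [k0 sg]; split; [apply: XG|apply: YH];
  by split=> // d dG; apply: sg; rewrite mem_cat dG ?orbT.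
Qed.

Lemma near_psi_imp (X Y : {rmorphism D -> K} -> Prop) :
  near_psi X -> (forall phi, X phi -> Y phi) -> near_psi Y.
Proof. by move=> [G XG] XY; exists G => phi /XG/XY. Qed.

Lemma near_psi_sgz d : near_psi (fun phi => sgz (phi d) = sgz (psi d)).
Proof. by exists [:: d] => phi [_]; apply; rewrite mem_head. Qed.

Lemma near_psi_ker : near_psi (fun phi => forall d, psi d = 0 -> phi d = 0).
Proof. by exists [::] => phi []. Qed.

Lemma near_psi_seq (T : eqType) (s : seq T) (X : T -> {rmorphism D -> K} -> Prop) :
  (forall t, t \in s -> near_psi (X t)) ->
  near_psi (fun phi => forall t, t \in s -> X t phi).
Proof.
elim: s => [|t s IH] Xs; first by exists [::].
have Xt := Xs t (mem_head _ _).
have /IH Xs' : forall u, u \in s -> near_psi (X u).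
  by move=> u us; apply: Xs; rewrite inE us orbT.
apply: near_psi_imp (near_psi_and Xt Xs') _ => phi [Xphi Xsphi] u.
by rewrite inE => /predU1P[->|]; [|exact: Xsphi].
Qed.

Lemma map_poly_ker phi P Q : (forall d, psi d = 0 -> phi d = 0) ->
  map_poly psi P = map_poly psi Q -> map_poly phi P = map_poly phi Q.
Proof.
move=> k0 /polyP PQ; apply/polyP => n; move: (PQ n); rewrite !coef_map => /eqP.
by rewrite -subr_eq0 -rmorphB => /eqP/k0/eqP; rewrite rmorphB subr_eq0 => /eqP.
Qed.

(** [psi] may kill leading coefficients of [P]. After truncation the formal leading coefficient
    survives, so its sign alone controls degree and leading sign under [phi]. *)
Lemma ex_truncation P : exists P0,
  map_poly psi P = map_poly psi P0 /\ size P0 = size (map_poly psi P).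
Proof.
pose n := size (map_poly psi P); pose P0 := \poly_(k < n) P`_k.
have E1 : map_poly psi P = map_poly psi P0.
  apply/polyP => k; rewrite !coef_map coef_poly /=.
  by case: ltnP => // nk; rewrite -coef_map nth_default // rmorph0.
exists P0; split=> //; apply/eqP; rewrite eqn_leq size_poly /=.
by rewrite E1 size_poly.
Qed.

Lemma near_psi_shape P : near_psi (fun phi =>
  sgz (lead_coef (map_poly phi P)) = sgz (lead_coef (map_poly psi P)) /\
  size (map_poly phi P) = size (map_poly psi P)).
Proof.
have [P0 [PP0 sP0]] := ex_truncation P.
apply: near_psi_imp (near_psi_and near_psi_ker (near_psi_sgz (lead_coef P0))) _.
move=> phi [k0 sl]; rewrite (map_poly_ker k0 PP0) PP0.
have [P00|P00] := eqVneq P0 0; first by rewrite P00 !rmorph0 !lead_coef0 !sgz0 !size_poly0.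
have psi0 : psi (lead_coef P0) != 0.
  rewrite /lead_coef -coef_map -PP0 sP0 -/(lead_coef _) lead_coef_eq0.
  by rewrite -size_poly_gt0 -sP0 size_poly_gt0.
have phi0 : phi (lead_coef P0) != 0 by rewrite -sgz_eq0 sl sgz_eq0.
by rewrite !lead_coef_map_eq // !size_map_poly_id0.
Qed.

End SignCompatibility.

(** The signs at the two infinities differ exactly in odd degree, so [crossR] depends only on the
    data of [near_psi_shape]. *)
Lemma crossRE (F : rcfType) (p : {poly F}) :
  crossR p = sgz (lead_coef p) *+ odd (size p).-1.
Proof.
have [->|p0] := eqVneq p 0; first by rewrite crossR0 lead_coef0 sgz0 mul0rn.
rewrite /crossR /variation /sgp_minfty /sgp_pinfty sgz_sgr -mulr_natr; congr (_ * _).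
rewrite !sgrEz -intrM sgzM sgzX sgzN1 -mulrA -signr_odd mulz_sg lead_coef_eq0 p0 mulr1.
by case: odd; rewrite ?expr1 ?expr0 ?ltrN10 ?ltr10.
Qed.

Lemma changes_mods_scale (F : rcfType) (q s : {poly F}) (c : F) :
  0 < c -> changes_mods q (c *: s) = changes_mods q s.
Proof.
move=> c0; rewrite !changes_mods_cindex; apply: eq_bigr => x _.
by rewrite jump_mulCp gtr0_sgz // mul1r.
Qed.

(** Any pseudo-division with positive multiplier yields the remainder up to a positive factor. Hence
    a division carried out in D[X] can replace the one performed over each field. *)
Lemma changes_mods_pseudo (F : rcfType) (p q h s : {poly F}) (v : F) :
  0 < v -> v *: p = h * q + s -> (size s < size q)%N ->
  changes_mods q (next_mod p q) = changes_mods q (- s).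
Proof.
move=> v0 E1 sq.
have q0 : q != 0 by rewrite -size_poly_gt0 (leq_trans _ sq).
set l := lead_coef q ^+ Pdiv.Ring.rscalp p q.
have l0 : l != 0 by rewrite expf_neq0 // lead_coef_eq0.
have E2 := Pdiv.ComRing.rdivp_eq q p; rewrite -/l in E2.
have sr : (size (Pdiv.Ring.rmodp p q) < size q)%N by rewrite Pdiv.Ring.ltn_rmodp.
have E3 : v *: Pdiv.Ring.rmodp p q = l *: s.
  (* Uniqueness of the remainder: the difference is a multiple of [q] of smaller degree than [q]. *)
  apply/eqP; rewrite -subr_eq0; apply: contraTT isT => d0.
  have E4 : v *: Pdiv.Ring.rmodp p q - l *: s = (l *: h - v *: Pdiv.Ring.rdivp p q) * q.
    rewrite (_ : Pdiv.Ring.rmodp p q = l *: p - Pdiv.Ring.rdivp p q * q);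
      last by rewrite E2 addrC addKr.
    rewrite (_ : s = v *: p - h * q); last by rewrite E1 addrC addKr.
    rewrite !scalerBr !scalerA mulrBl !scalerAl [v * l]mulrC.
    by rewrite opprB addrC addrA subrK.
  have : (size (v *: Pdiv.Ring.rmodp p q - l *: s)%R < size q)%N.
    rewrite (leq_ltn_trans (size_polyD _ _)) // size_polyN gtn_max.
    by rewrite !(leq_ltn_trans (size_scale_leq _ _)).
  rewrite {}E4 in d0 *; move: d0; rewrite mulf_eq0 negb_or => /andP[a0 _].
  rewrite ltnNge size_mul //; move: a0; rewrite -size_poly_gt0.
  by case: (size _) => // m _; rewrite addSn leq_addl.
rewrite /next_mod (_ : _ *: _ = (l ^+ 2 / v) *: (- s)).
  by rewrite changes_mods_scale // divr_gt0 // exprn_even_gt0.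
rewrite -/l scaleNr scalerN; congr (- _).
have vn0 : v != 0 by rewrite gt_eqF.
apply: (scalerI vn0); rewrite [LHS]scalerA [v * l]mulrC -scalerA E3 !scalerA.
by rewrite [v * _]mulrC divfK.
Qed.

Section TarskiQueryTransfer.
Variables (D : comNzRingType) (E K : rcfType) (psi : {rmorphism D -> E}).
Implicit Types (phi : {rmorphism D -> K}) (P Q : {poly D}).

Lemma near_changes_mods P Q : near_psi (K := K) psi (fun phi =>
  changes_mods (map_poly phi P) (map_poly phi Q) =
  changes_mods (map_poly psi P) (map_poly psi Q)).
Proof.
have [n] := ubnP (size (map_poly psi Q)); elim: n => // n IH in P Q *.
rewrite ltnS => sQn.
have [Q0 [QQ0 sQ0]] := ex_truncation psi Q.
have [Qz|Qz] := eqVneq (map_poly psi Q) 0.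
  apply: near_psi_imp (near_psi_ker _ _) _ => phi k0.
  rewrite Qz (map_poly_ker (P := Q) (Q := 0) k0) ?rmorph0 //.
  by rewrite !changes_modsp0.
(* The division is multiplied once more by [l ^+ k]: the multiplier becomes an even power of [l],
   positive whatever the sign of [l]. *)
pose k := Pdiv.Ring.rscalp P Q0; pose l := lead_coef Q0.
pose S := l ^+ k *: Pdiv.Ring.rmodp P Q0; pose H := l ^+ k *: Pdiv.Ring.rdivp P Q0.
have Q00 : Q0 != 0 by rewrite -size_poly_gt0 sQ0 size_poly_gt0.
have pdiv : l ^+ (k + k) *: P = H * Q0 + S.
  by rewrite exprD -scalerA Pdiv.ComRing.rdivp_eq scalerDr scalerAl.
have sS : (size S < size Q0)%N.
  by rewrite (leq_ltn_trans (size_scale_leq _ _)) // Pdiv.Ring.ltn_rmodp.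
have rec (F : rcfType) (f : {rmorphism D -> F}) : f l != 0 ->
    changes_mods (map_poly f P) (map_poly f Q0) =
    crossR (map_poly f (P * Q0)) + changes_mods (map_poly f Q0) (map_poly f (- S)).
  move=> fl; rewrite changes_mods_rec -rmorphM; congr (_ + _).
  rewrite rmorphN; apply: (@changes_mods_pseudo _ _ _ (map_poly f H) _ (f l ^+ (k + k))).
  - by rewrite addnn exprn_even_gt0 ?odd_double // fl orbT.
  - by rewrite -rmorphM -rmorphD -pdiv /= map_polyZ rmorphXn.
  - by rewrite [X in (_ < X)%N]size_map_poly_id0 // (leq_ltn_trans _ sS) // size_poly.
have psil : psi l != 0.
  rewrite /l /lead_coef -coef_map -QQ0 sQ0 -/(lead_coef _).
  by rewrite lead_coef_eq0.
have [|G HG] := IH Q0 (- S).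
  rewrite rmorphN size_polyN (leq_trans _ sQn) // -sQ0 (leq_ltn_trans _ sS) //.
  exact: size_poly.
apply: near_psi_imp (near_psi_and (near_psi_and (near_psi_ker _ _) (near_psi_sgz _ _ l))
  (near_psi_and (near_psi_shape _ _ (P * Q0)) (ex_intro _ G HG))) _.
move=> phi [[k0 sl] [[sPQ sizePQ] HS]].
rewrite (map_poly_ker k0 QQ0) QQ0 !rec //; last by rewrite -sgz_eq0 sl sgz_eq0.
by rewrite HS !crossRE sPQ sizePQ.
Qed.

(** Tarski's theorem expresses the query through the remainder sequence of [P] and [deriv P * Q]. *)
Lemma near_taq P Q : near_psi (K := K) psi (fun phi =>
  taq (rootsR (map_poly phi P)) (map_poly phi Q) =
  taq (rootsR (map_poly psi P)) (map_poly psi Q)).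
Proof.
apply: near_psi_imp (near_changes_mods P (deriv P * Q)) _ => phi.
by rewrite !taq_taqR /taqR !deriv_map !rmorphM.
Qed.

(* Expanding the product writes this count as a sum of Tarski queries. *)
Lemma near_positive_count P (L : seq {poly D}) Q : near_psi (K := K) psi (fun phi =>
  \sum_(x <- rootsR (map_poly phi P)) sgz (map_poly phi Q).[x] *
    \prod_(q <- L) (sgz (map_poly phi q).[x] ^+ 2 + sgz (map_poly phi q).[x]) =
  \sum_(x <- rootsR (map_poly psi P)) sgz (map_poly psi Q).[x] *
    \prod_(q <- L) (sgz (map_poly psi q).[x] ^+ 2 + sgz (map_poly psi q).[x])).
Proof.
elim: L Q => [|q L IH] Q.
  have nilE (F : rcfType) (f : {rmorphism D -> F}) (s : seq F) :
      \sum_(x <- s) sgz (map_poly f Q).[x] *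
        \prod_(q <- [::]) (sgz (map_poly f q).[x] ^+ 2 + sgz (map_poly f q).[x]) =
      taq s (map_poly f Q).
    by apply: eq_bigr => x _; rewrite big_nil mulr1.
  by apply: near_psi_imp (near_taq P Q) _ => phi; rewrite !nilE.
have step (F : rcfType) (f : {rmorphism D -> F}) (s : seq F) :
    \sum_(x <- s) sgz (map_poly f Q).[x] *
      \prod_(q <- q :: L) (sgz (map_poly f q).[x] ^+ 2 + sgz (map_poly f q).[x]) =
    \sum_(x <- s) sgz (map_poly f (Q * q ^+ 2)).[x] *
      \prod_(q <- L) (sgz (map_poly f q).[x] ^+ 2 + sgz (map_poly f q).[x]) +
    \sum_(x <- s) sgz (map_poly f (Q * q)).[x] *
      \prod_(q <- L) (sgz (map_poly f q).[x] ^+ 2 + sgz (map_poly f q).[x]).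
  rewrite -big_split /=; apply: eq_bigr => x _.
  rewrite big_cons !rmorphM !hornerM !sgzM; ring.
apply: near_psi_imp (near_psi_and (IH (Q * q ^+ 2)) (IH (Q * q))) _ => phi [E1 E2].
by rewrite !step E1 E2.
Qed.

Lemma sgz_sqr_add_ge0 (F : rcfType) (x : F) : 0 <= sgz x ^+ 2 + sgz x.
Proof. by case: sgzP. Qed.

Lemma sgz_sqr_add_eq0 (F : rcfType) (x : F) : (sgz x ^+ 2 + sgz x == 0) = (x <= 0).
Proof. by case: sgzP. Qed.

(** Each factor of the count is 2 at a positive value and 0 otherwise, so for [Q = 1] the count is
    nonzero exactly when some root makes all of [L] positive. *)
Lemma near_root_positive P (L : seq {poly D}) x :
  map_poly psi P != 0 -> root (map_poly psi P) x ->
  (forall q, q \in L -> 0 < (map_poly psi q).[x]) ->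
  near_psi (K := K) psi (fun phi => exists y, root (map_poly phi P) y /\
    forall q, q \in L -> 0 < (map_poly phi q).[y]).
Proof.
move=> P0 rx Lx.
apply: near_psi_imp (near_psi_and (near_psi_shape _ _ P) (near_positive_count P L 1)) _.
move=> phi [[_ sP] E1].
have phiP0 : map_poly phi P != 0 by rewrite -size_poly_gt0 sP size_poly_gt0.
pose cnt (F : rcfType) (f : {rmorphism D -> F}) z :=
  \prod_(q <- L) (sgz (map_poly f q).[z] ^+ 2 + sgz (map_poly f q).[z]).
have cnt0 (F : rcfType) (f : {rmorphism D -> F}) z : 0 <= cnt F f z.
  by apply: prodr_ge0 => q _; exact: sgz_sqr_add_ge0.
have xr : x \in rootsR (map_poly psi P) by rewrite -roots_on_rootsR.
have : \sum_(y <- rootsR (map_poly phi P)) cnt K phi y != 0.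
  have oneE (F : rcfType) (f : {rmorphism D -> F}) (s : seq F) :
      \sum_(y <- s) sgz (map_poly f 1).[y] * cnt F f y = \sum_(y <- s) cnt F f y.
    by apply: eq_bigr => y _; rewrite rmorph1 hornerC sgz1 mul1r.
  move: E1; rewrite !oneE => ->; rewrite psumr_eq0 => [|y _]; last exact: cnt0.
  apply/allPn; exists x => //=; rewrite prodf_seq_neq0; apply/allP => q qL /=.
  by rewrite sgz_sqr_add_eq0 -ltNge Lx.
rewrite psumr_eq0 => [|y _]; last exact: cnt0.
move=> /allPn[y yr /=]; rewrite prodf_seq_neq0 => /allP yL.
exists y; split; first by move: yr; rewrite -roots_on_rootsR // => /andP[].
by move=> q /yL /=; rewrite sgz_sqr_add_eq0 -ltNge.
Qed.

(** If all of [L] can be made positive, this happens near one of the infinities, which leading signs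
    and degrees detect, or at a root of the derivative of the product, where [near_root_positive]
    applies. *)
Lemma near_positive (L : seq {poly D}) x :
  (forall q, q \in L -> 0 < (map_poly psi q).[x]) ->
  near_psi (K := K) psi (fun phi => exists y,
    forall q, q \in L -> 0 < (map_poly phi q).[y]).
Proof.
move=> Lx.
have shapes := near_psi_seq (s := L) (fun q _ => near_psi_shape K psi q).
have posP (F : rcfType) (f : {rmorphism D -> F}) y :
    \big[andb/true]_(q <- map (map_poly f) L) (0 < q.[y]) <->
    (forall q, q \in L -> 0 < (map_poly f q).[y]).
  by rewrite big_map big_all; split=> [/allP|H]; last exact/allP.
have lead : (forall q, q \in L -> 0 < lead_coef (map_poly psi q)) ->
    near_psi (K := K) psi (fun phi => exists y,
      forall q, q \in L -> 0 < (map_poly phi q).[y]).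
  move=> lL; apply: near_psi_imp shapes _ => phi sh.
  have [y /posP yL] : exists y, \big[andb/true]_(q <- map (map_poly phi) L) (0 < q.[y]).
    apply/bounding_polyP; constructor 1; rewrite big_map big_all; apply/allP => q qL /=.
    by have [sq _] := sh q qL; rewrite -sgz_gt0 sq sgz_gt0 lL.
  by exists y.
have /bounding_polyP[] : exists y, \big[andb/true]_(q <- map (map_poly psi) L) (0 < q.[y]).
  by exists x; apply/posP.
- by rewrite big_map big_all => /allP /=; exact: lead.
- rewrite big_map big_all => /allP /= mL; apply: near_psi_imp shapes _ => phi sh.
  have [y /posP yL] : exists y, \big[andb/true]_(q <- map (map_poly phi) L) (0 < q.[y]).
    apply/bounding_polyP; constructor 2; rewrite big_map big_all; apply/allP => q qL /=.
    have [sq ss] := sh q qL; rewrite -sgz_gt0 sgzM sq ss.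
    have := mL q qL; rewrite -sgz_gt0 sgzM !sgzX !sgzN1.
    by [].
  by exists y.
move=> [y /andP[by0 /posP yL]].
pose P := deriv (\prod_(q <- L) q).
have bE : bounding_poly (map (map_poly psi) L) = map_poly psi P.
  by rewrite /bounding_poly /P -deriv_map rmorph_prod big_map.
have [P0|P0] := eqVneq (map_poly psi P) 0; last first.
  have ry : root (map_poly psi P) y by rewrite rootE -bE.
  apply: near_psi_imp (near_root_positive P0 ry yL) _ => phi [z [_ zL]].
  by exists z.
(* A vanishing derivative makes the product constant, hence every factor, and constants equal their
   leading coefficients. *)
apply: lead => q qL.
have prod0 : \prod_(q <- map (map_poly psi) L) q != 0.
  rewrite prodf_seq_neq0 all_map; apply/allP => r rL /=.
  by apply: contraTneq (yL r rL) => ->; rewrite horner0 ltxx.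
have : size (\prod_(q <- map (map_poly psi) L) q) == 1%N.
  have := congr1 (fun r : {poly E} => size r) P0.
  rewrite -bE size_deriv size_poly0 -subn1 => /eqP; rewrite subn_eq0 => s1.
  by rewrite eqn_leq s1 size_poly_gt0.
move=> /size_prod_eq1 /(_ (map_poly psi q) (map_f _ qL)) sq.
have := yL q qL; rewrite [map_poly psi q]size1_polyC ?sq // hornerC.
by rewrite lead_coefC.
Qed.
End TarskiQueryTransfer.

(** * Real points of finitely generated algebras *)

(** The Artin-Lang specialization property: the point [psi] over [E] can be moved to a point over
    [K] without changing finitely many signs. *)
Definition realizable (K E : rcfType) (D : comNzRingType)
    (iota : {rmorphism K -> D}) (psi : {rmorphism D -> E}) : Prop :=
  forall G : seq D, exists phi : {rmorphism D -> K},
    sign_compatible psi G phi /\ forall c, phi (iota c) = c.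

(** Nonnegative elements of a real closed field are squares, so order is preserved by every
    morphism. *)
Lemma rmorph_rcf_ge0 (K : rcfType) (E : realDomainType) (f : {rmorphism K -> E}) x :
  0 <= x -> 0 <= f x.
Proof. by move=> x0; rewrite -(sqr_sqrtr x0) rmorphXn sqr_ge0. Qed.

Lemma rmorph_rcf_sgz (K : rcfType) (E : realDomainType) (f : {rmorphism K -> E}) x :
  sgz (f x) = sgz x.
Proof.
case: (ltrgt0P x) => [x0|x0|->]; last by rewrite rmorph0 !sgz0.
  by rewrite !gtr0_sgz // lt_neqAle eq_sym fmorph_eq0 gt_eqF // rmorph_rcf_ge0 // ltW.
rewrite !ltr0_sgz // -oppr_gt0 -rmorphN lt_neqAle eq_sym fmorph_eq0 oppr_eq0 lt_eqF //.
by rewrite rmorph_rcf_ge0 // oppr_ge0 ltW.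
Qed.

Lemma realizable_id (K E : rcfType) (psi : {rmorphism K -> E}) :
  realizable idfun psi.
Proof.
move=> G; exists idfun; split=> //; split=> [d /eqP|d _] /=.
  by rewrite fmorph_eq0 => /eqP.
by rewrite rmorph_rcf_sgz.
Qed.

Section RealizablePoly.
Variables (K E : rcfType) (D : comNzRingType) (iota : {rmorphism K -> D}).
Variable psi : {rmorphism {poly D} -> E}.

Let psi0 : {rmorphism D -> E} := psi \o polyC.
Hypothesis psi0_real : realizable iota psi0.

Lemma rmorph_polyE P : psi P = (map_poly psi0 P).[psi 'X].
Proof.
rewrite /psi0 map_poly_comp horner_map /=; congr (psi _).
by rewrite -[RHS]/(P \Po 'X) comp_polyXr.
Qed.

(** Turns the sign conditions into strict positivity; the elements killed by [psi] are left to the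
    kernel condition. *)
Let strict (G : seq {poly D}) :=
  [seq (if 0 < psi g then g else - g) | g <- G & psi g != 0].

Lemma realizable_poly_of_point (G : seq {poly D}) :
  near_psi (K := K) psi0 (fun phi => exists y,
    (forall N, psi N = 0 -> (map_poly phi N).[y] = 0) /\
    (forall q, q \in strict G -> 0 < (map_poly phi q).[y])) ->
  exists phi : {rmorphism {poly D} -> K},
    sign_compatible psi G phi /\ forall c, phi (iota c)%:P = c.
Proof.
move=> [G0 GH]; have [phi [/GH[y [yk yL]] phic]] := psi0_real G0.
pose phi1 : {rmorphism {poly D} -> K} := horner_eval y \o map_poly phi.
exists phi1; split=> [|c]; last first.
  by rewrite /phi1 /= map_polyC /horner_eval hornerC /= phic.
split=> [N /yk //|g gG].
have [g0|g0] := eqVneq (psi g) 0; first by rewrite g0 [phi1 g]yk // !sgz0.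
have := yL (if 0 < psi g then g else - g).
have gS : (if 0 < psi g then g else - g) \in strict G.
  by apply/mapP; exists g; rewrite // mem_filter g0.
move=> /(_ gS); case: (ltP 0 (psi g)) => [gp|gn] pg.
  by rewrite (gtr0_sgz gp); apply: gtr0_sgz.
rewrite rmorphN hornerN oppr_gt0 in pg.
by rewrite (@ltr0_sgz _ (psi g)) ?lt_neqAle ?g0 //; exact: ltr0_sgz.
Qed.

Lemma strict_pos G q : q \in strict G -> 0 < (map_poly psi0 q).[psi 'X].
Proof.
move=> /mapP[g]; rewrite mem_filter -rmorph_polyE => /andP[g0 _ ->].
by case: (ltP 0 (psi g)) => // gn; rewrite rmorphN oppr_gt0 lt_neqAle g0.
Qed.

(** Either [psi 'X] is transcendental over the image of [psi0] and only positivity has to be met, or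
    it satisfies a relation of minimal degree and must move to a root of that relation. *)
Lemma realizable_poly : realizable (polyC \o iota) psi.
Proof.
move=> G; apply: realizable_poly_of_point.
pose dep P := map_poly psi0 P != 0 /\ psi P = 0.
have [[P depP]|nodep] := pselect (exists P, dep P); last first.
  apply: near_psi_imp (near_psi_and (near_psi_ker _ _) (near_positive K (@strict_pos G))) _.
  move=> phi [k0 [y yL]]; exists y; split=> // N N0.
  have N00 : map_poly psi0 N = map_poly psi0 0.
    rewrite rmorph0; apply/eqP; apply: contrapT => /negP Nn0.
    by apply: nodep; exists N.
  by rewrite (map_poly_ker k0 N00) rmorph0 horner0.
have exn : exists n, `[< exists2 Q, dep Q & size (map_poly psi0 Q) = n >].
  by exists (size (map_poly psi0 P)); apply/asboolP; exists P.
case: (ex_minnP exn) => n /asboolP[{depP}P [P0 Pe] sP] minP.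
have [P1 [PP1 sP1]] := ex_truncation psi0 P.
have rP1 : root (map_poly psi0 P1) (psi 'X) by rewrite -PP1 rootE -rmorph_polyE Pe.
rewrite PP1 in P0.
pose l := lead_coef P1.
have l0 : psi0 l != 0.
  by rewrite /l /lead_coef -coef_map sP1 PP1 -/(lead_coef _) lead_coef_eq0.
have P10 : P1 != 0 by apply: contraNneq P0 => ->; rewrite rmorph0.
apply: near_psi_imp (near_psi_and (near_psi_and (near_psi_ker _ _) (near_psi_sgz _ _ l))
  (near_root_positive K P0 rP1 (@strict_pos G))) _.
move=> phi [[k0 sl] [y [ry yL]]]; exists y; split=> // N N0.
have phil : phi l != 0 by rewrite -sgz_eq0 sl sgz_eq0.
(* The remainder of [N] is a relation of smaller degree, so by minimality [psi0], and then [phi],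
   kills its coefficients. Since [phi l] is nonzero, [N] vanishes at [y]. *)
pose k := Pdiv.Ring.rscalp N P1; pose H := Pdiv.Ring.rdivp N P1.
pose S := Pdiv.Ring.rmodp N P1.
have pdiv : l ^+ k *: N = H * P1 + S by exact: Pdiv.ComRing.rdivp_eq.
have S0 : psi S = 0.
  have : psi (l ^+ k *: N) = psi (H * P1 + S) by rewrite pdiv.
  rewrite -mul_polyC rmorphD !rmorphM N0 mulr0 [psi P1]rmorph_polyE (rootP rP1).
  by rewrite mulr0 add0r => <-.
have S00 : map_poly psi0 S = map_poly psi0 0.
  rewrite rmorph0; apply/eqP; apply: contrapT => /negP Sn0.
  have : (n <= size (map_poly psi0 S))%N by apply: minP; apply/asboolP; exists S.
  rewrite leqNgt -sP -sP1 (leq_ltn_trans (size_poly _ _)) //.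
  by rewrite Pdiv.Ring.ltn_rmodp.
have := congr1 (fun Q => (map_poly phi Q).[y]) pdiv.
rewrite map_polyZ rmorphD rmorphM /= hornerZ hornerD hornerM (rootP ry) mulr0 add0r.
rewrite (map_poly_ker k0 S00) rmorph0 horner0 => /eqP; rewrite rmorphXn mulf_eq0.
by rewrite expf_eq0 (negPf phil) andbF => /eqP.
Qed.

End RealizablePoly.

(** [D] is a polynomial ring with one variable per element of [s], adjoined one at a time so that
    [realizable_poly] applies at each stage. *)
Lemma ex_realizable_presentation (K : rcfType) (A : comNzRingType)
    (j : {rmorphism K -> A}) (s : seq A) :
  exists (D : comNzRingType) (iota : {rmorphism K -> D}) (pi : {rmorphism D -> A}),
  [/\ forall c, pi (iota c) = j c, forall a, a \in s -> exists d, pi d = a &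
      forall (E : rcfType) (psi : {rmorphism D -> E}), realizable iota psi].
Proof.
elim: s => [|a s [D [iota [pi [pij pis real]]]]].
  by exists K, idfun, j; split=> // E psi; exact: realizable_id.
exists {poly D}, (polyC \o iota), (horner_eval a \o map_poly pi); split.
- by move=> c; rewrite /= map_polyC /horner_eval hornerC /= pij.
- move=> b; rewrite inE => /predU1P[->|/pis[d <-]].
    by exists 'X; rewrite /= map_polyX /horner_eval hornerX.
  by exists d%:P; rewrite /= map_polyC /horner_eval hornerC.
- by move=> E psi; apply: realizable_poly; exact: real.
Qed.

Theorem ex_real_point (R : realType) (A : comAlgType R) (T : set A) (e : A) (G : seq A) :
  fg_algebra A -> preordering T -> avoids e T -> (forall g, g \in G -> T g) ->
  exists y : A -> R, [/\ Yset y, forall g, g \in G -> 0 <= y g & y e != 0].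
Proof.
move=> [s sgen] TP Te GT.
have [F [h [hT he _]]] := preordering_real_field TP Te.
have [E [h' h'P]] := ex_real_closure F.
have [D [iota [pi [pij pis real]]]] := ex_realizable_presentation (in_alg A) s.
have pi_surj a : exists d, pi d = a.
  elim: (sgen a) => [b /pis //||b c _ [d <-] _ [d' <-]|b c _ [d <-] _ [d' <-]|c b _ [d <-]].
  - by exists 1; rewrite rmorph1.
  - by exists (d + d'); rewrite rmorphD.
  - by exists (d * d'); rewrite rmorphM.
  - by exists (iota c * d); rewrite rmorphM pij /= mulr_algl.
have /choice[sec secP] := pi_surj.
have [phi [[k0 sg] phic]] := real E (h' \o h \o pi) (map sec (e :: G)).
(* [psi] factors through [pi], so [phi] kills the kernel of [pi]; this makes [phi \o sec] a
   homomorphism although [sec] is only a set-theoretic section. *)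
have phiE d : phi (sec (pi d)) = phi d.
  apply/eqP; rewrite -subr_eq0 -rmorphB; apply/eqP/k0.
  by rewrite /= rmorphB secP subrr !rmorph0.
have sgE a : a \in e :: G -> sgz (phi (sec a)) = sgz (h' (h a)).
  by move=> aG; rewrite sg ?map_f //= secP.
exists (phi \o sec); split=> [|g gG|] /=.
- split=> [a b|a b|c a|] /=.
  + by rewrite -{1}(secP a) -{1}(secP b) -rmorphD phiE rmorphD.
  + by rewrite -{1}(secP a) -{1}(secP b) -rmorphM phiE rmorphM.
  + by rewrite -{1}(secP a) -mulr_algl -[_%:A]pij -rmorphM phiE rmorphM phic.
  + by rewrite -(rmorph1 pi) phiE rmorph1.
- rewrite -sgz_ge0 sgE ?inE ?gG ?orbT // sgz_ge0.
  by apply: h'P; apply: hT; exact: GT.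
- by rewrite -sgz_eq0 sgE ?mem_head // sgz_eq0 fmorph_eq0.
Qed.

(** * The certificates *)

Section PointwiseTopology.
Variables (R : realType) (A : choiceType).
Implicit Types (z : A -> R) (S : set (A -> R)).

Lemma nbhs_ptws_box z (B : set (A -> R)) :
  nbhs (z : {ptws A -> R}) B ->
  exists (s : seq A) (eps : R), 0 < eps /\
    forall y : A -> R, (forall b, b \in s -> `|z b - y b| < eps) -> B y.
Proof.
pose box (i : seq A * R) : set (A -> R) :=
  [set y | forall b, b \in i.1 -> `|z b - y b| < i.2].
pose D : set (seq A * R) := [set i | 0 < i.2].
have FF : Filter (filter_from D box).
  apply: filter_from_filter; first by exists ([::], 1); rewrite /D /= ltr01.
  move=> [s e] [t d] /= e0 d0; exists (s ++ t, Num.min e d).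
    by rewrite /D /= lt_min e0.
  by move=> y yb; split=> b bs; have := yb b; rewrite /= mem_cat bs ?orbT => /(_ isT);
    rewrite lt_min => /andP[].
suff Fz : filter_from D box --> (z : {ptws A -> R}).
  by move=> /Fz[[s e] e0 sB]; exists s, e.
(* The topology is the supremum of those induced by the evaluations, so convergence is checked
   coordinatewise; constant functions show that evaluation is onto. *)
apply/cvg_sup => a; apply/cvg_image.
  by rewrite eqEsubset; split=> v // _; exists (cst v).
move=> W /nbhs_ballP[e /= e0 eW]; exists (@^~ a @^-1` W); last first.
  by rewrite eqEsubset; split=> [v [y + <-]//|v Wv]; exists (cst v).
exists ([:: a], e) => //= y; rewrite /box /= => /(_ a).
by rewrite mem_head => /(_ isT) yb; exact: eW.
Qed.

Lemma closure_ptwsP S z :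
  closure (S : set {ptws A -> R}) z <->
  forall (s : seq A) (eps : R), 0 < eps ->
    exists y, S y /\ forall b, b \in s -> `|z b - y b| < eps.
Proof.
split=> [clS s eps eps0|box B /nbhs_ptws_box[s [eps [eps0 sB]]]]; last first.
  by have [y [Sy yb]] := box s eps eps0; exists y; split=> //; exact: sB.
have /clS[y [Sy yb]] : nbhs (z : {ptws A -> R})
    [set y : A -> R | forall b, b \in s -> `|z b - y b| < eps].
  have zF : Filter (nbhs (z : {ptws A -> R})) := nbhs_filter _.
  elim: s => [|b s IH]; first by apply: (filterS _ (@filterT _ _ zF)) => y _ b.
  have zb := @proj_continuous A (fun _ => R : topologicalType) b z _
    (nbhsx_ballx (z b) eps eps0).
  apply: (@filterS _ _ zF _ _ _ (@filterI _ _ zF _ _ zb IH)) => y [yb ys] c.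
  by rewrite inE => /predU1P[->|]; [exact: yb|exact: ys].
by exists y.
Qed.

End PointwiseTopology.

(** * Certificates from the absence of real points *)

Section Positivstellensatz.
Variables (R : realType) (A : comAlgType R).
Implicit Types (Q : set A) (f p q u : A).

Lemma sos_sqr p : sos (p ^+ 2).
Proof. by exists [:: p]; rewrite big_seq1. Qed.

Lemma qmodule_preordering Q : quadratic_module Q -> mul_closed Q -> preordering Q.
Proof.
move=> [Qadd Qsqr Q1] Qmul; split=> // a.
by rewrite -[a ^+ 2]mulr1; exact: Qsqr.
Qed.

(* With c = p f = u + q, expand (c + p)^2 f = c p f^2 + 2 c^2 + p c. *)
Lemma sos_certificate Q p q u f : preordering Q -> Q p -> Q q -> Q u ->
  p * f = u + q -> exists p' q', [/\ sos p', Q q' & p' * f = u ^+ 2 + q'].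
Proof.
move=> QP Qp Qq Qu E1; pose c := u + q; have Qc : Q c by exact: preord_add.
exists ((c + p) ^+ 2),
  (c * p * f ^+ 2 + p * c + (u ^+ 2 + (u * q) *+ 4 + (q ^+ 2) *+ 2)).
have Qn a n : Q a -> Q (a *+ n).
  by move=> Qa; rewrite -mulr_natr; apply: preord_mul => //; exact: preord_nat.
split; first exact: sos_sqr.
  apply: preord_add => //; apply: preord_add => //.
  - by apply: preord_mul => //; [exact: preord_mul|exact: preord_sqr].
  - exact: preord_mul.
  - by apply: preord_add => //; [exact: preord_sqr|apply: Qn; exact: preord_mul].
  - by apply: Qn; exact: preord_sqr.
transitivity (c * p * f ^+ 2 + p * c + c ^+ 2 *+ 2); last by rewrite /c; ring.
by rewrite /c -E1; ring.
Qed.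

Lemma real_homN (y : A -> R) a : Yset y -> y (- a) = - y a.
Proof. by move=> [_ _ yZ _]; rewrite -scaleN1r yZ mulN1r. Qed.

Lemma real_homB (y : A -> R) a b : Yset y -> y (a - b) = y a - y b.
Proof. by move=> Yy; have [yD _ _ _] := Yy; rewrite yD (real_homN _ Yy). Qed.

Lemma real_hom_sum (y : A -> R) (I : Type) (s : seq I) (F : I -> A) :
  Yset y -> y (\sum_(i <- s) F i) = \sum_(i <- s) y (F i).
Proof.
move=> [yD _ yZ _]; elim: s => [|i s IH]; last by rewrite !big_cons yD IH.
by rewrite !big_nil -(scale0r 0) yZ mul0r.
Qed.

Lemma real_homX (y : A -> R) a n : Yset y -> y (a ^+ n) = y a ^+ n.
Proof.
by move=> [_ yM _ y1]; elim: n => [|n IH]; rewrite ?expr0 // !exprS yM IH.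
Qed.

Lemma real_hom_sos (y : A -> R) p : Yset y -> sos p -> 0 <= y p.
Proof.
move=> Yy [s ->]; rewrite (real_hom_sum _ _ Yy); apply: sumr_ge0 => x _.
by rewrite (real_homX _ _ Yy) sqr_ge0.
Qed.

(** Without a certificate, [- f] can be adjoined to [Q] while avoiding [e], which yields a real
    point with [y e != 0] and [y f <= 0]. Nonnegativity at the finitely many generators of [Q] puts
    it in [KQY Q]. *)
Lemma ex_certificate (Q : set A) e f : fg_algebra A -> preordering Q -> fg_qmodule Q ->
  (forall y, KQY Q y -> y e != 0 -> 0 < y f) ->
  exists p q k, [/\ Q p, Q q & p * f = e ^+ (2 * k) + q].
Proof.
move=> fgA QP [g Qg] fpos; apply: contrapT => nocert.
have av : avoids e (adjoin Q (- f)).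
  move=> k [a [b [Qa Qb E1]]]; apply: nocert; exists b, a, k; split=> //.
  by rewrite -[e ^+ _]opprK E1; ring.
have gQ h : h \in g -> Q h.
  move=> /(nthP 0)[i ig <-]; rewrite Qg /=.
  exists 0, (fun j => if j == Ordinal ig then 1 else 0); split.
  - by exists [::]; rewrite big_nil.
  - move=> j; case: ifP => _; last by exists [::]; rewrite big_nil.
    by rewrite -(expr1n _ 2); exact: sos_sqr.
  - rewrite add0r (bigD1 (Ordinal ig)) //= eqxx mul1r big1 ?addr0 // => j /negPf ->.
    by rewrite mul0r.
have [|y [Yy yG ye]] := ex_real_point (G := - f :: g) fgA (preordering_adjoin QP (- f)) av.
  move=> h; rewrite inE => /predU1P[->|/gQ Qh]; first exact: adjoin_gen.
  exact: adjoin_sub.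
have /fpos/(_ ye) : KQY Q y.
  split=> // a; rewrite Qg => -[s0 [s [s0s ss ->]]].
  have [yD yM _ _] := Yy.
  rewrite yD (real_hom_sum _ _ Yy) addr_ge0 ?(real_hom_sos Yy) // sumr_ge0 // => i _.
  rewrite yM; apply: mulr_ge0; first exact: real_hom_sos.
  by apply: yG; rewrite inE mem_nth ?orbT.
have := yG (- f) (mem_head _ _).
by rewrite (real_homN _ Yy) oppr_ge0 ltNge => ->.
Qed.

End Positivstellensatz.

(** * The two equivalences *)

Section KrivineStengle.
Variables (R : realType) (X : Type) (A : comAlgType R) (bar : A -> X -> R) (Q : set A).
Hypothesis fgA : fg_algebra A.
Hypothesis barP : alg_hom_fun bar.

Lemma Yset_mmap x : Yset (mmap bar x).
Proof. by have [bD bM bZ b1] := barP; split=> *; rewrite /mmap. Qed.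

Lemma KQY_mmap x : KQX bar Q x -> KQY Q (mmap bar x).
Proof. by move=> Qx; split; [exact: Yset_mmap|exact: Qx]. Qed.

Lemma Yset_eq (s : seq A) (y z : A -> R) : (forall a, in_subalg s a) ->
  Yset y -> Yset z -> (forall a, a \in s -> y a = z a) -> y = z.
Proof.
move=> sgen [yD yM yZ y1] [zD zM zZ z1] yz; apply/funext => a.
elim: (sgen a) => [b /yz//||b c _ Hb _ Hc|b c _ Hb _ Hc|c b _ Hb].
- by rewrite y1 z1.
- by rewrite yD zD Hb Hc.
- by rewrite yM zM Hb Hc.
- by rewrite yZ zZ Hb.
Qed.

(** At a point [z] this is the squared distance to [y] in the coordinates [s]. *)
Definition sqdist (s : seq A) (y : A -> R) : A :=
  \sum_(a <- s) (a - (y a)%:A) ^+ 2.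

Lemma eval_sqdist (s : seq A) (y z : A -> R) : Yset z ->
  z (sqdist s y) = \sum_(a <- s) (z a - y a) ^+ 2.
Proof.
move=> Zz; have [_ _ zZ z1] := Zz.
rewrite (real_hom_sum _ _ Zz); apply: eq_bigr => a _.
by rewrite (real_homX _ _ Zz) (real_homB _ _ Zz) zZ z1 mulr1.
Qed.

Lemma positivity_iff : quadratic_module Q -> fg_qmodule Q -> mul_closed Q ->
  (forall f : A, (forall x, KQX bar Q x -> 0 < bar f x) ->
      exists p q : A, [/\ sos p, Q q & p * f = 1 + q])
    <-> mmap bar @` KQX bar Q = KQY Q.
Proof.
move=> qmQ fgQ mcQ; have QP := qmodule_preordering qmQ mcQ.
split=> [cert|mE f fpos].
  apply/seteqP; split=> [_ [x Qx <-]|y Ky]; first exact: KQY_mmap.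
  have [Yy yQ] := Ky; have [yD yM yZ y1] := Yy.
  apply: contrapT => ny; have [s sgen] := fgA.
  have [x Qx|p [q [sp Qq E1]]] := cert (sqdist s y).
    have Yx := Yset_mmap x.
    rewrite -/(mmap bar x _) (eval_sqdist _ _ Yx) lt_neqAle sumr_ge0 ?andbT => [|a _]; last first.
      exact: sqr_ge0.
    rewrite eq_sym psumr_eq0 => [|a _]; last exact: sqr_ge0.
    apply/negP => /allP /= xy; apply: ny; exists x => //.
    apply: (Yset_eq sgen Yx Yy) => a /xy.
    by rewrite sqrf_eq0 subr_eq0 => /eqP.
  (* At [y] the certificate reads [0 = 1 + y q] with [y q] nonnegative. *)
  have := congr1 y E1; rewrite yM yD y1 (eval_sqdist _ _ Yy).
  rewrite big1 ?mulr0 => [E2|a _]; last by rewrite subrr expr0n.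
  by have := yQ q Qq; rewrite -(lerD2l 1) -E2 addr0 ler10.
have [|p [q [k [Qp Qq]]]] := ex_certificate (e := 1) (f := f) fgA QP fgQ.
  by move=> y; rewrite -mE => -[x Qx <-] _; exact: fpos.
rewrite expr1n => /(sos_certificate QP Qp Qq (preord1 QP)).
by rewrite expr1n => -[p' [q' ?]]; exists p', q'.
Qed.

Lemma nonnegativity_iff : quadratic_module Q -> fg_qmodule Q -> mul_closed Q ->
  (forall f : A, (forall x, KQX bar Q x -> 0 <= bar f x) ->
      exists (p q : A) (k : nat), [/\ sos p, Q q & p * f = f ^+ (2 * k) + q])
    <-> closureY (mmap bar @` KQX bar Q) = KQY Q.
Proof.
move=> qmQ fgQ mcQ; have QP := qmodule_preordering qmQ mcQ.
have closed_ge0 f y : (forall x, KQX bar Q x -> 0 <= bar f x) ->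
    closureY (mmap bar @` KQX bar Q) y -> 0 <= y f.
  move=> f0 [_ /closure_ptwsP cl]; rewrite leNgt; apply/negP => yf.
  (* Within distance [- y f] of [y], an image point still has a negative value at [f]. *)
  have [_ [[x Qx <-] /(_ f (mem_head _ _))]] := cl [:: f] (- y f) ltac:(by rewrite oppr_gt0).
  rewrite ltr_norml opprK => /andP[].
  rewrite ltrBDr addrC -ltrBDr subrr => xf _.
  by have := f0 x Qx; rewrite leNgt => /negP; apply.
split=> [cert|mE f fpos].
  apply/seteqP; split=> [y cy|y [Yy yQ]].
    split; first by case: cy.
    by move=> g Qg; apply: closed_ge0 cy => x; exact.
  split=> //; apply/closure_ptwsP => s eps eps0; apply: contrapT => nbox.
  have [yD yM yZ y1] := Yy.
  have [x Qx|p [q [k [sp Qq E1]]]] := cert (sqdist s y - (eps ^+ 2)%:A).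
    have Yx := Yset_mmap x; have [_ _ xZ x1] := Yx.
    rewrite -/(mmap bar x _) (real_homB _ _ Yx) (eval_sqdist _ _ Yx) xZ x1 mulr1 subr_ge0.
    (* An image point outside the box differs from [y] by at least [eps] in some coordinate, so this
       single square already reaches [eps ^+ 2]. *)
    have [b bs eb] : exists2 b, b \in s & eps <= `|y b - mmap bar x b|.
      apply: contrapT => nb; apply: nbox; exists (mmap bar x); split; first by exists x.
      move=> b bs; rewrite ltNge; apply/negP => eb; apply: nb; by exists b.
    rewrite (big_rem b) //= -[eps ^+ 2]addr0 lerD ?sumr_ge0 // => [|a _]; last exact: sqr_ge0.
    by rewrite -[leRHS]real_normK ?num_real // distrC ler_sqr ?nnegrE // ltW.
  (* At [y] the left side is [y p] times [- eps ^+ 2], hence at most 0, while the right side is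
     positive. *)
  have := congr1 y E1; rewrite yM [y (_ ^+ _ + q)]yD (real_homX _ _ Yy) (real_homB _ _ Yy).
  rewrite (eval_sqdist _ _ Yy) yZ y1 mulr1 big1 ?sub0r => [E2|a _]; last first.
    by rewrite subrr expr0n.
  have : 0 < (- eps ^+ 2) ^+ (2 * k) + y q.
    by rewrite ltr_wpDr ?yQ // exprM sqrrN !exprn_gt0.
  rewrite -E2 mulrN oppr_gt0 ltNge => /negP; apply.
  by rewrite mulr_ge0 ?sqr_ge0 // (real_hom_sos Yy).
(* Taking [e := f] asks for positivity only where [f] does not vanish, which nonnegativity
   supplies. *)
have [|p [q [k [Qp Qq E1]]]] := ex_certificate (e := f) (f := f) fgA QP fgQ.
  move=> y; rewrite -mE => cy yf; rewrite lt_neqAle eq_sym yf /=.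
  exact: closed_ge0 cy.
have [p' [q' [sp' Qq' E2]]] := sos_certificate QP Qp Qq (preord_even QP f k) E1.
(* Passing to a sum of squares squared [f ^+ (2 * k)], which doubles [k]. *)
by exists p', q', (k + k)%N; rewrite mulnDr exprD.
Qed.

End KrivineStengle.

Theorem theorem1p4 (R : realType) (X : Type) (A : comAlgType R)
  (bar : A -> X -> R) (Q : set A) :
  fg_algebra A -> alg_hom_fun bar ->
  quadratic_module Q -> fg_qmodule Q -> mul_closed Q ->
  ((forall f : A, (forall x, KQX bar Q x -> 0 < bar f x) ->
      exists p q : A, [/\ sos p, Q q & p * f = 1 + q])
    <-> mmap bar @` KQX bar Q = KQY Q)
  /\
  ((forall f : A, (forall x, KQX bar Q x -> 0 <= bar f x) ->
      exists (p q : A) (k : nat), [/\ sos p, Q q & p * f = f ^+ (2 * k) + q])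
    <-> closureY (mmap bar @` KQX bar Q) = KQY Q).
Proof.
move=> fgA barP qmQ fgQ mcQ.
by split; [exact: positivity_iff|exact: nonnegativity_iff].
Qed.
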